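(* Let $f:\mathbb{R}^d\to\mathbb{R}$, $f(x)=\mathbb{E}_{\xi\sim\Xi(x)}[F(x;\xi)]$, be bounded below, $L$-Lipschitz continuous, and differentiable with $L_g$-Lipschitz gradient: $\|\nabla f(x)-\nabla f(y)\|\le L_g\|x-y\|$ for all $x,y$. Suppose the stochastic zeroth-order oracle (SZO) satisfies $\mathbb{E}_{\xi\sim\Xi(x)}[F(x;\xi)]=f(x)$ and $\mathbb{E}_{\xi\sim\Xi(x)}[|F(x;\xi)-f(x)|^2]\le\sigma^2$ for all $x\in\mathbb{R}^d$. Let $\delta=\frac{\epsilon}{4L_g}$. Then the algorithm ZO-O2NC (described in the context) with smoothing radius $\delta$, with either Option I or Option II and suitable choices of its remaining inputs $M,K,\eta$, finds an $\epsilon$-stationary point of $f$ in expectation, i.e. its output $\bar y_{k_{\rm out}}$ satisfies $\mathbb{E}[\|\nabla f(\bar y_{k_{\rm out}})\|]\le\epsilon$, using $$N_{\rm SZO}=\mathcal{O}(d^2\epsilon^{-6})$$ SZO calls.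
   Context: Notation. $\|\cdot\|$ is the Euclidean norm, $\mathbb{B}(x,r)$ the closed ball of radius $r$ about $x$, $\mathbb{S}^{d-1}$ the unit sphere in $\mathbb{R}^d$, $\Pi_S$ Euclidean projection onto a closed convex set $S$. For each $x\in\mathbb{R}^d$, $\Xi(x)$ is a probability distribution depending on $x$. An SZO call at a point $x$ draws $\xi\sim\Xi(x)$ and returns $F(x;\xi)$; conditionally on its query point, each call is independent of all previous randomness and of the other calls. Constants: $L,L_g>0$, $\sigma\ge0$. A point $x$ is $\epsilon$-stationary if $\|\nabla f(x)\|\le\epsilon$. Algorithm ZO-O2NC. Inputs: smoothing radius $\delta>0$, block length $M\in\mathbb{N}$, number of blocks $K\in\mathbb{N}$, stepsize $\eta>0$, Option I or II. Set $D=\delta/M$, $T=KM$, $x_0=0$. (Option II only: set $y_0=0$, sample $u_0\sim\mathrm{Unif}(\mathbb{S}^{d-1})$, $\xi_0\sim\Xi(y_0+\delta u_0)$, and query $F(y_0+\delta u_0;\xi_0)$.) For $k=1,\dots,K$: set $\Delta_{(k-1)M+1}=0$; for $m=1,\dots,M$, with $t=(k-1)M+m$: sample $s_t\sim\mathrm{Unif}[0,1]$; set $y_t=x_{t-1}+s_t\Delta_t$ and $x_t=x_{t-1}+\Delta_t$; sample $u_t\sim\mathrm{Unif}(\mathbb{S}^{d-1})$; construct $g_t$; if $m<M$ set $\Delta_{t+1}=\Pi_{\mathbb{B}(0,D)}(\Delta_t-\eta g_t)$. All $s_t,u_t$ are fresh independent samples. Here - Option I: $g_t=\frac{d}{2\delta}\big(F(y_t+\delta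 u_t;\xi_t^+)-F(y_t-\delta u_t;\xi_t^-)\big)u_t$ with $\xi_t^\pm\sim\Xi(y_t\pm\delta u_t)$ drawn independently of each other (two SZO calls per iteration); - Option II: $g_t=\frac{d}{\delta}\big(F(y_t+\delta u_t;\xi_t)-F(y_{t-1}+\delta u_{t-1};\xi_{t-1})\big)u_t$ with $\xi_t\sim\Xi(y_t+\delta u_t)$; the second value is reused from the previous iteration (one new SZO call per iteration). Output: sample $k_{\rm out}\sim\mathrm{Unif}\{1,\dots,K\}$ independently and return $\bar y_{k_{\rm out}}=\frac1M\sum_{t=(k_{\rm out}-1)M+1}^{k_{\rm out}M}y_t$. $\mathcal{O}(\cdot)$ hides a constant depending only on $\gamma=f(x_0)-\inf f$, $\sigma$, $L$, $L_g$ (not on $d$ or $\epsilon$), and is understood for all sufficiently small $\epsilon>0$. *)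

(* Defs.v *)
From HB Require Import structures.
From mathcomp Require Import all_boot all_order all_algebra.
From mathcomp Require Import all_classical all_reals all_analysis.

Set Implicit Arguments.
Unset Strict Implicit.
Unset Printing Implicit Defensive.

Import Order.TTheory GRing.Theory Num.Theory.
Import numFieldNormedType.Exports.

Local Open Scope classical_set_scope.
Local Open Scope ring_scope.

(* The library puts a topology, but no sigma-algebra, on matrices: R^n, i.e.
   'rV[R]_n, is equipped here with its Borel sigma-algebra. *)
Definition matrix_borel_display : measure_display.
Proof. exact: default_measure_display. Qed.

Section matrix_borel.
Variables (R : realType) (m n : nat).

Let borel : set (set 'M[R]_(m, n)) := <<s [set A | open A] >>.

Let borel0 : borel set0.
Proof. exact: sigma_algebra0. Qed.

Let borelC A : borel A -> borel (~` A).
Proof. exact: sigma_algebraC. Qed.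

Let borel_bigcup (A : (set 'M[R]_(m, n))^nat) :
  (forall i, borel (A i)) -> borel (\bigcup_i A i).
Proof. exact: sigma_algebra_bigcup. Qed.

HB.instance Definition _ := @isMeasurable.Build matrix_borel_display
  'M[R]_(m, n) borel borel0 borelC borel_bigcup.

End matrix_borel.

Section euclidean.
Context {R : realType} {d : nat}.
Implicit Types (x z p : 'rV[R]_d) (S : set 'rV[R]_d).

(* The library norm `|x| on 'rV[R]_d is the sup norm; it induces the same
   topology and the same notion of differentiability. *)
Definition enorm x : R := Num.sqrt (\sum_i x 0 i ^+ 2).

Definition eball x (r : R) : set 'rV[R]_d := [set z | enorm (z - x) <= r].

Definition esphere : set 'rV[R]_d := [set z | enorm z = 1].

(* p is the Euclidean projection of z onto S (unique when S is convex). *)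
Definition is_eproj S z p : Prop :=
  S p /\ forall q, S q -> enorm (z - p) <= enorm (z - q).

Definition grad (f : 'rV[R]_d -> R) x : 'rV[R]_d :=
  \row_i 'D_(delta_mx 0 i) f x.

(* The uniform distribution on the unit sphere, i.e. the rotation-invariant
   Borel probability measure carried by the sphere (it exists and is unique
   for d > 0). *)
Definition is_unif_sphere (mu : probability 'rV[R]_d R) : Prop :=
  mu esphere = 1%E /\
  forall Q : 'M[R]_d, Q *m Q^T = 1%:M -> forall A : set 'rV[R]_d,
    measurable A -> mu [set z | A (z *m Q)] = mu A.

End euclidean.

Section conditional_law.
Context {dO : measure_display} {O : measurableType dO} {R : realType}.
Context {dT : measure_display} {T : measurableType dT}.

(* sigma-algebra generated by G and the random variable Z *)
Definition add_rv (G : set_system O) (Z : O -> T) : set_system O :=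
  <<s G `|` preimage_set_system setT Z measurable >>.

(* kappa is the conditional law of Z given the sigma-algebra G.  For a constant
   kappa this says that Z has law kappa and is independent of G. *)
Definition cond_law (P : probability O R) (G : set_system O) (Z : O -> T)
    (kappa : O -> set T -> \bar R) : Prop :=
  measurable_fun setT Z /\
  forall (A : set O) (B : set T), G A -> measurable B ->
    P (A `&` Z @^-1` B) = (\int[P]_(w in A) kappa w B)%E.

End conditional_law.

Variant szo_option := OptionI | OptionII.

(* Option I: two calls in each of the K * M iterations.  Option II: one call in
   each iteration, plus the initial one. *)
Definition nb_szo (opt : szo_option) (M K : nat) : nat :=
  match opt with
  | OptionI => (2 * (K * M))%N
  | OptionII => (K * M).+1%N
  end.

(* Sigma-algebra of all the randomness drawn up to the end of iteration t.
   xi t stands for xi_t^+ under Option I and for xi_t under Option II; xi' t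
   stands for xi_t^- and is used under Option I only. *)
Fixpoint history {R : realType} {d : nat} {dX dO : measure_display}
    {X : measurableType dX} {O : measurableType dO} (opt : szo_option)
    (s : nat -> O -> R) (u : nat -> O -> 'rV[R]_d) (xi xi' : nat -> O -> X)
    (t : nat) {struct t} : set_system O :=
  match t, opt with
  | 0, OptionI => [set set0; setT]
  | 0, OptionII => add_rv (add_rv [set set0; setT] (u 0)) (xi 0)
  | t'.+1, OptionI =>
      add_rv (add_rv (add_rv (add_rv (history opt s u xi xi' t')
        (s t)) (u t)) (xi t)) (xi' t)
  | t'.+1, OptionII =>
      add_rv (add_rv (add_rv (history opt s u xi xi' t') (s t)) (u t)) (xi t)
  end.

Section algorithm.
Context {R : realType} {d : nat}.
Context {dX : measure_display} {X : measurableType dX}.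
Context {dO : measure_display} {O : measurableType dO}.
Variables (P : probability O R) (mu : probability 'rV[R]_d R).
Variables (Xi : R.-pker 'rV[R]_d ~> X) (F : 'rV[R]_d -> X -> R).
Variables (opt : szo_option) (delta : R) (M K : nat) (eta : R).

(* An execution of ZO-O2NC on the probability space (O, P), mu being the law of
   the directions u_t.  Iterations are numbered t = 1, ..., K * M; iteration
   t = k * M + m, with k < K and 1 <= m <= M, is the m-th one of block k + 1.
   Values of the sequences at other indices are irrelevant, except for x_0 and,
   under Option II, y_0, u_0 and xi_0. *)
Record zo_o2nc_run := ZoO2ncRun {
  run_s : nat -> O -> R;
  run_u : nat -> O -> 'rV[R]_d;
  run_xi : nat -> O -> X;
  run_xi' : nat -> O -> X;
  run_kout : O -> nat;
  run_x : nat -> O -> 'rV[R]_d;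
  run_y : nat -> O -> 'rV[R]_d;
  run_Delta : nat -> O -> 'rV[R]_d;
  run_g : nat -> O -> 'rV[R]_d;

  run_x0 : forall w, run_x 0 w = 0;

  run_Delta_reset : forall k, (k < K)%N -> forall w,
    run_Delta (k * M).+1%N w = 0;

  run_yE : forall t, (1 <= t <= K * M)%N -> forall w,
    run_y t w = run_x t.-1 w + run_s t w *: run_Delta t w;

  run_xE : forall t, (1 <= t <= K * M)%N -> forall w,
    run_x t w = run_x t.-1 w + run_Delta t w;

  run_gE : forall t, (1 <= t <= K * M)%N -> forall w,
    run_g t w =
    match opt with
    | OptionI =>
        (d%:R / (2 * delta) *
          (F (run_y t w + delta *: run_u t w) (run_xi t w)
           - F (run_y t w - delta *: run_u t w) (run_xi' t w)))
        *: run_u t w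
    | OptionII =>
        (d%:R / delta *
          (F (run_y t w + delta *: run_u t w) (run_xi t w)
           - F (run_y t.-1 w + delta *: run_u t.-1 w) (run_xi t.-1 w)))
        *: run_u t w
    end;

  run_Delta_update : forall k m, (k < K)%N -> (1 <= m < M)%N -> forall w,
    is_eproj (eball 0 (delta / M%:R))
      (run_Delta (k * M + m)%N w - eta *: run_g (k * M + m)%N w)
      (run_Delta (k * M + m).+1%N w);

  run_init : opt = OptionII ->
    [/\ forall w, run_y 0 w = 0,
        cond_law P [set set0; setT] (run_u 0) (fun=> mu) &
        cond_law P (add_rv [set set0; setT] (run_u 0)) (run_xi 0)
          (fun w => Xi (run_y 0 w + delta *: run_u 0 w))];

  run_s_law : forall t, (1 <= t <= K * M)%N ->
    cond_law P (history opt run_s run_u run_xi run_xi' t.-1)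
      (run_s t : O -> measurableTypeR R) (fun=> uniform_prob (@ltr01 R));

  run_u_law : forall t, (1 <= t <= K * M)%N ->
    cond_law P
      (add_rv (history opt run_s run_u run_xi run_xi' t.-1) (run_s t))
      (run_u t) (fun=> mu);

  run_xi_law : forall t, (1 <= t <= K * M)%N ->
    cond_law P
      (add_rv (add_rv (history opt run_s run_u run_xi run_xi' t.-1)
        (run_s t)) (run_u t))
      (run_xi t) (fun w => Xi (run_y t w + delta *: run_u t w));

  run_xi'_law : opt = OptionI -> forall t, (1 <= t <= K * M)%N ->
    cond_law P
      (add_rv (add_rv (add_rv (history opt run_s run_u run_xi run_xi' t.-1)
        (run_s t)) (run_u t)) (run_xi t))
      (run_xi' t) (fun w => Xi (run_y t w - delta *: run_u t w));

  run_kout_measurable : measurable_fun setT run_kout;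

  run_kout_law : forall k, (1 <= k <= K)%N -> forall A : set O,
    history opt run_s run_u run_xi run_xi' (K * M)%N A ->
    P (A `&` run_kout @^-1` [set k]) = ((K%:R^-1)%:E * P A)%E
}.

Definition run_output (r : zo_o2nc_run) (w : O) : 'rV[R]_d :=
  M%:R^-1 *: \sum_(((run_kout r w).-1 * M + 1)%N <= t < (run_kout r w * M).+1%N)
    run_y r t w.

End algorithm.

(* Main.v *)
Require Import Defs.
From HB Require Import structures.
From mathcomp Require Import all_boot all_order all_algebra.
From mathcomp Require Import all_classical all_reals all_analysis measurable_realfun.
From mathcomp Require Import ring lra.
Import Order.TTheory GRing.Theory Num.Theory.
Import numFieldNormedType.Exports.
Local Open Scope classical_set_scope.
Local Open Scope ring_scope.
Set Implicit Arguments.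
Unset Strict Implicit.
Unset Printing Implicit Defensive.

(** Write [D = delta / M] and let [G y] ([sgrad]) be the mean of
    [d / delta * f (y + delta u) u] for [u] uniform on the unit sphere.

    Bias. The dimension-free bound [|G y - grad f y| <= Lg * delta] ([sgrad_bias])
    needs no divergence theorem. For a unit vector [e], let [u'] be the image of
    [u] under the reflection in the hyperplane orthogonal to [e]. By invariance,
    [dot (G y) e] is the mean of
    [d / (2 delta) * (f (y + delta u) - f (y + delta u')) * dot u e].
    The two points differ by [2 delta (dot u e) e] and lie in the ball of radius
    [delta] about [y], so the mean value theorem replaces the difference by
    [2 delta (dot u e) (dot (grad f y) e)] up to [2 Lg delta^2 |dot u e|]. It
    remains to know that [(dot u e)^2] has mean [1 / d]
    ([unif_sphere_second_moment]), which follows from invariance under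
    reflections as well.

    Noise. Conditionally on the past and on [s_t], the estimator [g_t] has mean
    [G y_t] under either option ([g_unbiased]): the oracle noise is centered given
    [u_t], and the value reused by Option II multiplies the centered [u_t]. Its
    second moment is at most a constant times [d^2 (sigma^2 / delta^2 + L^2)]
    ([g_second_moment]), that is [O(d^2 / eps^2)]. Hence the increments
    [n_t = g_t - G y_t] are orthogonal, and their sum over a block of length [M]
    has second moment at most [M B^2], where [B = O(d / eps)]. Both facts rest on
    one integration formula for conditional laws ([cond_law_integral]).

    Descent. Since [x_t - x_(t-1) = Delta_t], and [y_t] lies on the segment
    between these two points, the decrease of [f] over a block is
    [- \sum_t dot (grad f y_t) Delta_t] up to [M Lg D^2]. The regret bound of projected gradient descent
    on the losses [dot g_t], against the comparator of norm [D] opposite to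
    [\sum_t grad f y_t], turns this decrease into a bound on
    [D |\sum_t grad f y_t|] ([block_gradient_sum]). As a block has diameter at
    most [M D = delta], the gradient at the mean of its points differs from the
    mean of the gradients by at most [Lg delta] ([block_average]).

    Average. Taking expectations and averaging over the blocks, the decreases of
    [f] telescope ([output_expect]) and the expected gradient norm is at most
    [gamma / (K delta) + Lg D + 2 B / sqrt M + 3 Lg delta] for the best step size.
    The last term is [3 / 4 eps]; the others are absorbed by [M = O(d^2 / eps^4)]
    and [K = O(1 / eps^2)] ([parameters_bound], [szo_count]). *)


(** * Euclidean geometry of rows and projection onto a ball *)

Section euclidean_space.
Context {R : realType} {d : nat}.
Implicit Types x y z p q : 'rV[R]_d.

Definition dot x y : R := \sum_i x 0 i * y 0 i.

Lemma dotC x y : dot x y = dot y x.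
Proof. by apply: eq_bigr => i _; rewrite mulrC. Qed.

Lemma dotDl x y z : dot (x + y) z = dot x z + dot y z.
Proof. by rewrite /dot -big_split; apply: eq_bigr => i _; rewrite mxE mulrDl. Qed.

Lemma dotZl a x y : dot (a *: x) y = a * dot x y.
Proof. by rewrite /dot mulr_sumr; apply: eq_bigr => i _; rewrite mxE mulrA. Qed.

Lemma dotNl x y : dot (- x) y = - dot x y.
Proof. by rewrite -scaleN1r dotZl mulN1r. Qed.

Lemma dotBl x y z : dot (x - y) z = dot x z - dot y z.
Proof. by rewrite dotDl dotNl. Qed.

Lemma dotDr x y z : dot x (y + z) = dot x y + dot x z.
Proof. by rewrite dotC dotDl !(dotC _ x). Qed.

Lemma dotZr a x y : dot x (a *: y) = a * dot x y.
Proof. by rewrite dotC dotZl dotC. Qed.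

Lemma dotNr x y : dot x (- y) = - dot x y.
Proof. by rewrite dotC dotNl dotC. Qed.

Lemma dotBr x y z : dot x (y - z) = dot x y - dot x z.
Proof. by rewrite dotDr dotNr. Qed.

Lemma dot0l x : dot 0 x = 0.
Proof. by rewrite -(scale0r x) dotZl mul0r. Qed.

Lemma dot0r x : dot x 0 = 0.
Proof. by rewrite dotC dot0l. Qed.

Lemma dot_sumr (I : Type) (r : seq I) (Q : pred I) (V : I -> 'rV[R]_d) x :
  dot x (\sum_(i <- r | Q i) V i) = \sum_(i <- r | Q i) dot x (V i).
Proof.
by elim/big_rec2: _ => [|i a b _ <-]; rewrite ?dot0r ?dotDr.
Qed.

Lemma dot_deltar x i : dot x (delta_mx 0 i) = x 0 i.
Proof.
rewrite /dot (bigD1 i)//= big1 ?addr0 => [|j ji]; rewrite mxE eqxx ?eqxx/= ?mulr1//.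
by rewrite (negbTE ji) mulr0.
Qed.

Lemma dot_mxE x y : dot x y = (x *m y^T) 0 0.
Proof. by rewrite mxE; apply: eq_bigr => i _; rewrite mxE. Qed.

Lemma dotxx_ge0 x : 0 <= dot x x.
Proof. by apply: sumr_ge0 => i _; rewrite -expr2 sqr_ge0. Qed.

Lemma enorm_ge0 x : 0 <= enorm x.
Proof. exact: sqrtr_ge0. Qed.

Lemma enorm_sqr x : enorm x ^+ 2 = dot x x.
Proof.
rewrite sqr_sqrtr; last by apply: sumr_ge0 => i _; exact: sqr_ge0.
by apply: eq_bigr => i _; rewrite expr2.
Qed.

Lemma enorm_eq0 x : (enorm x == 0) = (x == 0).
Proof.
apply/idP/eqP => [|->]; last first.
  by rewrite /enorm big1 ?sqrtr0// => i _; rewrite mxE expr0n.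
rewrite -sqrf_eq0 enorm_sqr psumr_eq0 => [/allP x0|i _].
  by apply/rowP => i; have := x0 i; rewrite mem_index_enum mulf_eq0 orbb mxE => /(_ erefl)/eqP.
by rewrite -expr2 sqr_ge0.
Qed.

Lemma enorm0 : enorm (0 : 'rV[R]_d) = 0.
Proof. by apply/eqP; rewrite enorm_eq0. Qed.

Lemma enormZ a x : enorm (a *: x) = `|a| * enorm x.
Proof.
apply/eqP; rewrite -(@eqrXn2 _ 2)// ?mulr_ge0 ?enorm_ge0//.
by rewrite exprMn real_normK ?num_real// !enorm_sqr dotZl dotZr; apply/eqP; ring.
Qed.

Lemma enormN x : enorm (- x) = enorm x.
Proof. by rewrite -scaleN1r enormZ normrN1 mul1r. Qed.

(** Expand the squared norm of [enorm y *: x - (dot x y / enorm y) *: y]. *)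
Lemma cauchy_schwarz x y : dot x y <= enorm x * enorm y.
Proof.
have [y0|y0] := eqVneq y 0; first by rewrite y0 dot0r enorm0 mulr0.
have yn0 : 0 < enorm y by rewrite lt_neqAle eq_sym enorm_eq0 y0 enorm_ge0.
have := dotxx_ge0 (enorm y *: x - (dot x y / enorm y) *: y).
rewrite dotBl !dotBr !dotZl !dotZr -!enorm_sqr (dotC y x) => h.
have {}h : dot x y ^+ 2 <= (enorm x * enorm y) ^+ 2.
  rewrite -subr_ge0; apply: le_trans h _; rewrite le_eqVlt; apply/orP; left.
  by apply/eqP; field; rewrite gt_eqF.
apply: le_trans (ler_norm _) _.
by rewrite -(@ler_pXn2r _ 2) ?nnegrE ?mulr_ge0 ?enorm_ge0// real_normK ?num_real.
Qed.

Lemma enorm_delta i : enorm (delta_mx 0 i : 'rV[R]_d) = 1.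
Proof.
apply/eqP; rewrite -(@eqrXn2 _ 2)// ?enorm_ge0//.
by rewrite enorm_sqr dot_deltar mxE !eqxx expr1n.
Qed.

Lemma cauchy_schwarz_abs x y : `|dot x y| <= enorm x * enorm y.
Proof.
rewrite ler_norml cauchy_schwarz andbT lerNl -dotNl -(enormN x).
exact: cauchy_schwarz.
Qed.

Lemma enormD x y : enorm (x + y) <= enorm x + enorm y.
Proof.
rewrite -(@ler_pXn2r _ 2) ?nnegrE ?addr_ge0 ?enorm_ge0//.
rewrite sqrrD !enorm_sqr dotDl !dotDr (dotC y x).
by have := cauchy_schwarz x y; lra.
Qed.

Lemma enormB x y : enorm (x - y) <= enorm x + enorm y.
Proof. by rewrite -(enormN y) enormD. Qed.

Lemma enorm_sum (I : Type) (r : seq I) (Q : pred I) (V : I -> 'rV[R]_d) :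
  enorm (\sum_(i <- r | Q i) V i) <= \sum_(i <- r | Q i) enorm (V i).
Proof.
elim/big_rec2: _ => [|i a b _ h]; first by rewrite enorm0.
by apply: le_trans (enormD _ _) _; rewrite lerD2l.
Qed.

Lemma coord_le_enorm x i : `|x 0 i| <= enorm x.
Proof.
rewrite -(@ler_pXn2r _ 2) ?nnegrE ?enorm_ge0// real_normK ?num_real// enorm_sqr.
rewrite /dot (bigD1 i)//= -expr2 lerDl sumr_ge0// => j _.
by rewrite -expr2 sqr_ge0.
Qed.

Lemma enorm_sqrD x y : enorm (x + y) ^+ 2 = enorm x ^+ 2 + 2 * dot x y + enorm y ^+ 2.
Proof. by rewrite !enorm_sqr dotDl !dotDr (dotC y x); ring. Qed.

Lemma enorm_sqrB x y : enorm (x - y) ^+ 2 = enorm x ^+ 2 - 2 * dot x y + enorm y ^+ 2.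
Proof. by rewrite enorm_sqrD dotNr enormN; ring. Qed.

Lemma enormD_sqr_le x y : enorm (x + y) ^+ 2 <= 2 * enorm x ^+ 2 + 2 * enorm y ^+ 2.
Proof.
have := sqr_ge0 (enorm (x - y)); rewrite enorm_sqrD enorm_sqrB; lra.
Qed.

(** The first-order condition: moving from the minimiser towards any other
    point of the ball cannot decrease the distance. *)
Lemma eproj_eball_obtuse (r : R) z p q :
  is_eproj (eball 0 r) z p -> eball 0 r q -> dot (z - p) (q - p) <= 0.
Proof.
move=> [pr pmin] qr; rewrite leNgt; apply/negP => dgt0.
have [qp|qp] := eqVneq (enorm (q - p)) 0.
  by move/eqP: qp dgt0; rewrite enorm_eq0 => /eqP ->; rewrite dot0r ltxx.
set a := dot _ _ in dgt0; set n := enorm (q - p) in qp.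
have n0 : 0 < n by rewrite lt_neqAle eq_sym qp enorm_ge0.
(* any step shorter than 2 a / n ^+ 2 would come strictly closer *)
pose t := Num.min 1 (a / n ^+ 2).
have t0 : 0 < t by rewrite lt_min ltr01 divr_gt0// exprn_gt0.
have t1 : t <= 1 by rewrite ge_min lexx.
have tn : t * n ^+ 2 <= a by rewrite -ler_pdivlMr ?exprn_gt0// ge_min lexx orbT.
have : eball 0 r (p + t *: (q - p)).
  move: pr qr; rewrite /eball /= !subr0 => pr qr.
  rewrite (_ : p + _ = (1 - t) *: p + t *: q); last first.
    by apply/rowP => i; rewrite !mxE; ring.
  apply: le_trans (enormD _ _) _; rewrite !enormZ !ger0_norm ?subr_ge0 ?(ltW t0)//.
  rewrite (_ : r = (1 - t) * r + t * r); last by ring.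
  by rewrite lerD ?ler_wpM2l ?subr_ge0 ?(ltW t0).
move=> /pmin; rewrite -(@ler_pXn2r _ 2) ?nnegrE ?enorm_ge0//.
rewrite opprD addrA (enorm_sqrB (z - p)) dotZr enormZ exprMn real_normK ?num_real//.
rewrite -/a -/n; have : t * (t * n ^+ 2) <= t * a by rewrite ler_wpM2l// ltW.
have := mulr_gt0 t0 dgt0; lra.
Qed.

(** The angle at [p] between [z] and [q] is obtuse. *)
Lemma eproj_eball_closer (r : R) z p q :
  is_eproj (eball 0 r) z p -> eball 0 r q -> enorm (p - q) <= enorm (z - q).
Proof.
move=> hp hq; have h := eproj_eball_obtuse hp hq.
rewrite -(@ler_pXn2r _ 2) ?nnegrE ?enorm_ge0//.
rewrite (_ : z - q = (z - p) - (q - p)); last by rewrite opprB addrA subrK.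
rewrite (enorm_sqrB (z - p)) -(enormN (q - p)) opprB.
by have := sqr_ge0 (enorm (z - p)); move: h; lra.
Qed.

(** An explicit formula, hence a measurable one. It holds because the rescaled
    point satisfies the same first-order condition as the projection, and
    adding the two conditions forces the points to agree. *)
Lemma eproj_eballE (r : R) z p : 0 < r -> is_eproj (eball 0 r) z p ->
  p = (r / Num.max r (enorm z)) *: z.
Proof.
move=> r0 hp; set q := _ *: z.
have m0 : 0 < Num.max r (enorm z) by rewrite lt_max r0.
have ar0 : 0 <= r / Num.max r (enorm z) by rewrite divr_ge0 ?ltW.
have hq : eball 0 r q.
  rewrite /eball /= subr0 enormZ ger0_norm// mulrAC ler_pdivrMr//.
  by rewrite ler_wpM2l ?(ltW r0)// le_max lexx orbT.
have pq := eproj_eball_obtuse hp hq.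
suff qp : dot (z - q) (p - q) <= 0.
  apply/eqP; rewrite -subr_eq0 -enorm_eq0 -sqrf_eq0 eq_le sqr_ge0 andbT enorm_sqr.
  move: pq qp; rewrite !dotBl !dotBr (dotC q p); lra.
rewrite (_ : z - q = (1 - r / Num.max r (enorm z)) *: z); last by rewrite scalerBl scale1r.
rewrite dotZl dotBr dotZr -enorm_sqr.
have [zr|rz] := leP (enorm z) r.
  by rewrite divff ?gt_eqF// subrr mul0r.
rewrite mulr_ge0_le0// ?subr_ge0 ?ler_pdivrMr ?mul1r ?(ltW rz)// ?(lt_trans r0)//.
rewrite expr2 mulrA divfK ?gt_eqF ?(lt_trans r0)// subr_le0.
apply: le_trans (cauchy_schwarz _ _) _; rewrite mulrC ler_wpM2r ?enorm_ge0//.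
by case: hp; rewrite /eball /= subr0.
Qed.

End euclidean_space.

(** * Measurability of row-valued functions *)

Section borel_rows.
Context {R : realType} {n : nat}.

Lemma continuous_measurable_row (f : 'rV[R]_n -> R) :
  continuous f -> measurable_fun setT f.
Proof.
move=> /continuousP cf; apply: (measurability _ (RGenOpens.measurableE R)).
move=> _ [_ [a [b ->] <-]]; rewrite setTI; apply: sub_sigma_algebra.
exact/cf/interval_open.
Qed.

Lemma measurable_coord i : measurable_fun setT (fun x : 'rV[R]_n => x 0 i).
Proof. by apply: continuous_measurable_row; exact: coord_continuous. Qed.

(** Rational boxes form a countable base, so that the Borel sigma-algebra of
    [R^n] is generated by the coordinates. *)
Lemma measurable_rowP {dT} {T : measurableType dT} (h : T -> 'rV[R]_n) :
  measurable_fun setT h <-> forall i, measurable_fun setT (fun w => h w 0 i).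
Proof.
split=> [mh i|mh]; first exact: (measurableT_comp (measurable_coord i)).
apply: (measurability [set A : set 'rV[R]_n | open A]) => //.
move=> _ [A oA <-]; rewrite setTI.
pose q2r (q : 'rV[rat]_n) : 'rV[R]_n := map_mx ratr q.
pose box (p : 'rV[rat]_n * nat) : set 'rV[R]_n :=
  [set x | forall i, `|q2r p.1 0 i - x 0 i| < p.2.+1%:R^-1].
have -> : A = \bigcup_(p in [set p | box p `<=` A]) box p.
  apply/seteqP; split=> [x Ax|x [p /= pA]]; last exact: pA.
  have /nbhs_ballP[e /= e0 xeA] : nbhs x A by apply: open_nbhs_nbhs; split.
  have e20 : 0 < e / 2 by rewrite divr_gt0.
  pose k := Num.truncn (e / 2)^-1.
  have ke : k.+1%:R^-1 < e / 2.
    rewrite -[ltRHS]invrK ltf_pV2 ?posrE ?invr_gt0//.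
    by rewrite /k truncnS_gt.
  have /choice[q hq] : forall i, exists q : rat, `|ratr q - x 0 i| < k.+1%:R^-1.
    move=> i; have : x 0 i - k.+1%:R^-1 < x 0 i + k.+1%:R^-1.
      by rewrite ltrBlDr -addrA ltrDl addr_gt0 ?invr_gt0.
    move=> /rat_in_itvoo[q]; rewrite in_itv /= => /andP[q1 q2]; exists q.
    by rewrite ltr_norml ltrBrDl q1 ltrBlDl q2.
  exists (\row_i q i, k) => [/= z zb|i /=]; last by rewrite !mxE; exact: hq.
  apply: xeA; split=> // j i; rewrite (ord1 j) /ball /=.
  have := zb i; rewrite /= !mxE => {}zb.
  rewrite (_ : _ - _ = (x 0 i - ratr (q i)) + (ratr (q i) - z 0 i)); last by ring.
  apply: le_lt_trans (ler_normD _ _) _; rewrite (splitr e) ltrD//.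
    by rewrite distrC (lt_trans (hq i)).
  exact: lt_trans zb _.
rewrite preimage_bigcup bigcup_mkcond.
apply: countable_bigcupT_measurable => [|p]; first exact: countableP.
case: ifP => // _.
rewrite (_ : _ @^-1` _ = \bigcap_(i in [set` 'I_n])
    [set w | `|q2r p.1 0 i - h w 0 i| < p.2.+1%:R^-1]); last first.
  by apply/seteqP; split=> w /= H i; [move=> _|]; exact: H.
apply: fin_bigcap_measurable => // i _.
have mdist : measurable_fun setT (fun w => `|q2r p.1 0 i - h w 0 i|).
  by apply: measurableT_comp => //; exact: measurable_funB.
have := mdist measurableT `]-oo, p.2.+1%:R^-1[%classic (measurable_itv _).
by rewrite setTI; congr measurable; apply/seteqP; split=> w /=; rewrite in_itv.
Qed.

Lemma enorm_le_mx_norm (x : 'rV[R]_n) : enorm x <= n%:R * `|x|.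
Proof.
rewrite {1}(row_sum_delta x); apply: le_trans (enorm_sum _ _ _) _.
apply: (@le_trans _ _ (\sum_(i < n) `|x|)); last first.
  by rewrite sumr_const card_ord mulr_natl.
apply: ler_sum => i _; rewrite enormZ enorm_delta mulr1 [leRHS]mx_normrE.
apply: (le_bigmax _ (fun j => `|x j.1 j.2|) (0, i)).
Qed.

Lemma lipschitz_measurable (f : 'rV[R]_n -> R) (k : R) :
  (forall x y, `|f x - f y| <= k * enorm (x - y)) -> measurable_fun setT f.
Proof.
move=> fk; apply: continuous_measurable_row => x.
apply/(@cvgrPdist_lt _ _ _ (nbhs x) (nbhs_filter x)) => e e0.
have k1 : 0 < `|k| * n%:R + 1 by rewrite ltr_wpDl// mulr_ge0.
apply/nbhs_ballP; exists (e / (`|k| * n%:R + 1)) => /=; first by rewrite divr_gt0.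
move=> y; rewrite mx_norm_ball /ball_ /= ltr_pdivlMr// mulrC => xy.
apply: le_lt_trans (fk _ _) _; apply: le_lt_trans xy.
apply: (@le_trans _ _ (`|k| * n%:R * `|x - y|)); last first.
  by rewrite ler_wpM2r// lerDl.
rewrite -mulrA; apply: (@le_trans _ _ (`|k| * enorm (x - y))).
  by rewrite ler_wpM2r ?enorm_ge0// ler_norm.
by rewrite ler_wpM2l// enorm_le_mx_norm.
Qed.

Lemma enorm_lipschitz (x y : 'rV[R]_n) : `|enorm x - enorm y| <= enorm (x - y).
Proof.
have h z w : enorm z <= enorm w + enorm (z - w).
  by rewrite -{1}(subrKC w z) enormD.
by rewrite ler_norml lerBlDl h andbT lerBrDl lerBlDr -(enormN (x - y)) opprB h.
Qed.

Lemma measurable_enorm : measurable_fun setT (@enorm R n).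
Proof.
by apply: (@lipschitz_measurable _ 1) => x y; rewrite mul1r enorm_lipschitz.
Qed.

Lemma measurable_esphere : measurable (@esphere R n).
Proof.
rewrite -[X in measurable X]setTI.
exact: (measurable_enorm measurableT (measurable_set1 (1 : R))).
Qed.

(** A Lipschitz function: the denominators are at least [r]. *)
Lemma measurable_eproj_factor (r : R) : 0 < r ->
  measurable_fun setT (fun x : 'rV[R]_n => r / Num.max r (enorm x)).
Proof.
move=> r0; apply: (@lipschitz_measurable _ r^-1) => x y.
have m0 (z : 'rV[R]_n) : r <= Num.max r (enorm z) by rewrite le_max lexx.
have mp (z : 'rV[R]_n) := lt_le_trans r0 (m0 z).
have -> : r / Num.max r (enorm x) - r / Num.max r (enorm y) =
    r / (Num.max r (enorm x) * Num.max r (enorm y)) *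
    (Num.max r (enorm y) - Num.max r (enorm x)).
  by field; rewrite !gt_eqF.
rewrite normrM ger0_norm ?divr_ge0 ?mulr_ge0 ?(ltW r0) ?(ltW (mp _))//.
rewrite ler_pM ?divr_ge0 ?mulr_ge0 ?(ltW r0) ?(ltW (mp _))//.
  rewrite ler_pdivrMr ?mulr_gt0// -ler_pdivrMl ?invr_gt0// invrK.
  by rewrite ler_pM ?(ltW r0).
apply: le_trans (enorm_lipschitz x y); rewrite distrC.
rewrite ler_norml; have := ler_norm (enorm x - enorm y).
have := ler_norm (enorm y - enorm x); rewrite distrC.
by rewrite /Num.max; do 2!case: ifPn; rewrite -?leNgt; lra.
Qed.

Section row_valued.
Context {dT : measure_display} {T : measurableType dT}.
Implicit Types h g : T -> 'rV[R]_n.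

Lemma measurable_rowD h g : measurable_fun setT h -> measurable_fun setT g ->
  measurable_fun setT (fun w => h w + g w).
Proof.
move=> /measurable_rowP mh /measurable_rowP mg; apply/measurable_rowP => i.
by under eq_fun do rewrite mxE; exact: measurable_funD.
Qed.

Lemma measurable_rowZ (a : T -> R) h : measurable_fun setT a ->
  measurable_fun setT h -> measurable_fun setT (fun w => a w *: h w).
Proof.
move=> ma /measurable_rowP mh; apply/measurable_rowP => i.
by under eq_fun do rewrite mxE; exact: measurable_funM.
Qed.

Lemma measurable_rowB h g : measurable_fun setT h -> measurable_fun setT g ->
  measurable_fun setT (fun w => h w - g w).
Proof.
move=> /measurable_rowP mh /measurable_rowP mg; apply/measurable_rowP => i.
by under eq_fun do rewrite !mxE; exact: measurable_funB.
Qed.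

Lemma measurable_row_sum (I : eqType) (r : seq I) (h : I -> T -> 'rV[R]_n) :
  (forall i, i \in r -> measurable_fun setT (h i)) ->
  measurable_fun setT (fun w => \sum_(i <- r) h i w).
Proof.
elim: r => [_|i r IH mh].
  by under eq_fun do rewrite big_nil; exact: measurable_cst.
under eq_fun do rewrite big_cons; apply: measurable_rowD.
  by apply: mh; rewrite inE eqxx.
by apply: IH => j jr; apply: mh; rewrite inE jr orbT.
Qed.

Lemma measurable_dot h g : measurable_fun setT h -> measurable_fun setT g ->
  measurable_fun setT (fun w => dot (h w) (g w)).
Proof.
move=> /measurable_rowP mh /measurable_rowP mg.
by apply: measurable_sum => i; exact: measurable_funM.
Qed.

End row_valued.
End borel_rows.

(** * The mean value theorem along a segment *)

Section mean_value.
Context {R : realType} {d : nat}.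
Implicit Types (f : 'rV[R]_d -> R) (x v : 'rV[R]_d).

Lemma diff_grad f x v : differentiable f x -> 'd f x v = dot (grad f x) v.
Proof.
move=> df; rewrite {1}(row_sum_delta v) linear_sum; apply: eq_bigr => i _.
by rewrite linearZ /= mxE mulrC deriveE.
Qed.

Lemma is_derive_line f x v (t : R) : differentiable f (x + t *: v) ->
  is_derive t (1 : R) (fun s : R => f (x + s *: v)) (dot (grad f (x + t *: v)) v).
Proof.
move=> df.
have dl : is_diff t (fun s : R => x + s *: v) (fun s : R => s *: v).
  rewrite [X in is_diff _ _ X](_ : _ = 0 + *:%R ^~ v); last first.
    by apply/funext => s /=; rewrite add0r.
  exact: is_diffD.
have [ddl edl] := dl.
have dc : differentiable (f \o (fun s : R => x + s *: v)) t.
  exact: differentiable_comp.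
apply: DeriveDef; first exact/diff_derivable.
by rewrite deriveE// (diff_comp ddl df) /= edl scale1r diff_grad.
Qed.

Lemma mean_value_grad f (df : forall x, differentiable f x) x v :
  exists2 t : R, 0 <= t <= 1 & f (x + v) - f x = dot (grad f (x + t *: v)) v.
Proof.
have [||t t01] := @MVT_segment R (fun s : R => f (x + s *: v))
    (fun t => dot (grad f (x + t *: v)) v) 0 1 ler01.
- by move=> t _; exact: is_derive_line.
- apply: continuous_subspaceT => t.
  apply: differentiable_continuous; apply/derivable1_diffP.
  by apply: ex_derive; exact: is_derive_line.
by rewrite scale1r scale0r addr0 subr0 mulr1 => ->; exists t; rewrite // -in_itv.
Qed.

End mean_value.

(** * Integrable and square-integrable random variables *)

Section square_integrable.
Context {dT : measure_display} {T : measurableType dT} {R : realType}.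
Variable P : probability T R.
Implicit Types X Y : T -> R.

Definition L1 X := P.-integrable setT (EFin \o X).
Definition L2 X := measurable_fun setT X /\ L1 (fun w => X w ^+ 2).

Lemma L1_measurable X : L1 X -> measurable_fun setT X.
Proof. by move=> /integrableP[/measurable_EFinP]. Qed.

Lemma L1_le X Y : measurable_fun setT X -> L1 Y ->
  {ae P, forall w, `|X w| <= Y w} -> L1 X.
Proof.
move=> mX /integrableP[mY finY] XY; apply/integrableP; split.
  exact/measurable_EFinP.
apply: le_lt_trans finY; apply: ae_ge0_le_integral => //.
- by apply: measurableT_comp => //; exact/measurable_EFinP.
- exact: measurableT_comp.
- apply: filterS XY => w XYw _ /=; rewrite lee_fin.
  exact: le_trans XYw (ler_norm _).
Qed.

Lemma L1_cst c : L1 (fun=> c).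
Proof. exact: finite_measure_integrable_cst. Qed.

Lemma L1_bounded X c : measurable_fun setT X -> {ae P, forall w, `|X w| <= c} -> L1 X.
Proof. by move=> mX; apply: L1_le => //; exact: L1_cst. Qed.

Lemma L1D X Y : L1 X -> L1 Y -> L1 (fun w => X w + Y w).
Proof. exact: integrableD. Qed.

Lemma L1Z a X : L1 X -> L1 (fun w => a * X w).
Proof. exact: integrableZl. Qed.

Lemma L1B X Y : L1 X -> L1 Y -> L1 (fun w => X w - Y w).
Proof. exact: integrableB. Qed.

Lemma L1_sum (I : Type) (r : seq I) (X : I -> T -> R) :
  (forall i, L1 (X i)) -> L1 (fun w => \sum_(i <- r) X i w).
Proof.
move=> LX; elim: r => [|i r IH].
  by under eq_fun do rewrite big_nil; exact: L1_cst.
by under eq_fun do rewrite big_cons; exact: L1D.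
Qed.

Lemma expect_cst c : \int[P]_w c = c.
Proof. by rewrite Rintegral_cst//= probability_setT mulr1. Qed.

Lemma expectD X Y : L1 X -> L1 Y ->
  \int[P]_w (X w + Y w) = \int[P]_w X w + \int[P]_w Y w.
Proof. exact: RintegralD. Qed.

Lemma expectB X Y : L1 X -> L1 Y ->
  \int[P]_w (X w - Y w) = \int[P]_w X w - \int[P]_w Y w.
Proof. exact: RintegralB. Qed.

Lemma expectZ a X : L1 X -> \int[P]_w (a * X w) = a * \int[P]_w X w.
Proof. by move=> LX; rewrite RintegralZl. Qed.

Lemma expect_sum (I : Type) (r : seq I) (X : I -> T -> R) :
  (forall i, L1 (X i)) ->
  \int[P]_w (\sum_(i <- r) X i w) = \sum_(i <- r) \int[P]_w X i w.
Proof.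
move=> LX; elim: r => [|i r IH].
  by under eq_Rintegral do rewrite big_nil; rewrite big_nil expect_cst.
under eq_Rintegral do rewrite big_cons.
by rewrite expectD// ?IH ?big_cons//; exact: L1_sum.
Qed.

Lemma expect_ae_eq X Y : measurable_fun setT X -> measurable_fun setT Y ->
  {ae P, forall w, X w = Y w} -> \int[P]_w X w = \int[P]_w Y w.
Proof.
move=> mX mY XY; congr fine; apply: ae_eq_integral => //.
- exact/measurable_EFinP.
- exact/measurable_EFinP.
- by apply: filterS XY => w /= ->.
Qed.

Lemma expect_ae_le X Y : L1 X -> L1 Y -> {ae P, forall w, X w <= Y w} ->
  \int[P]_w X w <= \int[P]_w Y w.
Proof.
move=> LX LY XY.
have mX := L1_measurable LX; have mY := L1_measurable LY.
rewrite -subr_ge0 -expectB//.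
have LD : L1 (fun w => `|Y w - X w|) by apply: integrable_norm; exact: L1B.
rewrite (@expect_ae_eq _ (fun w => `|Y w - X w|)).
- exact: Rintegral_ge0.
- exact: measurable_funB.
- exact: L1_measurable LD.
- by apply: filterS XY => w; rewrite -subr_ge0 => /ger0_norm ->.
Qed.

Lemma L2_le X Y : measurable_fun setT X -> L2 Y ->
  {ae P, forall w, `|X w| <= `|Y w|} -> L2 X.
Proof.
move=> mX [mY LY] XY; split=> //; apply: (L1_le _ LY).
  exact: measurable_funX.
apply: filterS XY => w XYw; rewrite -[Y w ^+ 2]real_normK ?num_real// normrX.
by rewrite lerXn2r ?nnegrE.
Qed.

Lemma L2M X Y : L2 X -> L2 Y -> L1 (fun w => X w * Y w).
Proof.
move=> [mX LX] [mY LY]; apply: (L1_le _ (L1D LX LY)).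
  exact: measurable_funM.
apply: aeW => w; rewrite normrM -[X w ^+ 2]real_normK ?num_real//.
rewrite -[Y w ^+ 2]real_normK ?num_real//.
have := sqr_ge0 (`|X w| - `|Y w|); have := mulr_ge0 (normr_ge0 (X w)) (normr_ge0 (Y w)).
rewrite sqrrB; lra.
Qed.

Lemma L2Z a X : L2 X -> L2 (fun w => a * X w).
Proof.
move=> [mX LX]; split; first exact: measurable_funM.
by under eq_fun do rewrite exprMn; exact: L1Z.
Qed.

Lemma L2D X Y : L2 X -> L2 Y -> L2 (fun w => X w + Y w).
Proof.
move=> LX LY; split; first by apply: measurable_funD; [case: LX|case: LY].
under eq_fun do rewrite sqrrD.
apply: L1D; [apply: L1D|]; [by case: LX| |by case: LY].
by under eq_fun do rewrite -mulr_natl; apply: L1Z; exact: L2M.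
Qed.

Lemma L2B X Y : L2 X -> L2 Y -> L2 (fun w => X w - Y w).
Proof.
move=> LX /(L2Z (-1)) LY.
by under eq_fun do rewrite -mulN1r; exact: L2D.
Qed.

Lemma L2_sum (I : Type) (r : seq I) (X : I -> T -> R) :
  (forall i, L2 (X i)) -> L2 (fun w => \sum_(i <- r) X i w).
Proof.
move=> LX; elim: r => [|i r IH].
  under eq_fun do rewrite big_nil; split; first exact: measurable_cst.
  exact: L1_cst.
by under eq_fun do rewrite big_cons; exact: L2D.
Qed.

Lemma L2_bounded X c : measurable_fun setT X -> {ae P, forall w, `|X w| <= c} -> L2 X.
Proof.
move=> mX Xc; have Lc : L2 (fun=> c) by split; [exact: measurable_cst|exact: L1_cst].
apply: (L2_le mX Lc); apply: filterS Xc => w h; exact: le_trans h (ler_norm _).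
Qed.

Lemma L2_bounded_mul X Y c : measurable_fun setT X ->
  {ae P, forall w, `|X w| <= c} -> L2 Y -> L2 (fun w => X w * Y w).
Proof.
move=> mX Xc LY; apply: (L2_le _ (L2Z c LY)).
  by apply: measurable_funM => //; case: LY.
apply: filterS Xc => w h; rewrite !normrM ler_wpM2r//.
exact: le_trans h (ler_norm _).
Qed.

Lemma ae_forall_nat (Q : nat -> T -> Prop) (D : pred nat) :
  (forall n, D n -> {ae P, forall w, Q n w}) ->
  {ae P, forall w, forall n, D n -> Q n w}.
Proof.
move=> QP; apply/ae_foralln => n.
case: (boolP (D n)) => Dn; last by apply: aeW => w.
by apply: filterS (QP n Dn) => w ? _.
Qed.

End square_integrable.

(** * The uniform law on the sphere and the smoothed gradient *)

Section reflections.
Context {R : realType} {d : nat}.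
Implicit Types e u v : 'rV[R]_d.

(** Householder reflection, for a unit vector [e]. *)
Definition refl_mx e : 'M[R]_d := 1%:M - 2 *: (e^T *m e).

Lemma mulmx_refl e u : u *m refl_mx e = u - (2 * dot u e) *: e.
Proof.
rewrite mulmxBr mulmx1 -scalemxAr mulmxA.
by rewrite [u *m _]mx11_scalar mul_scalar_mx -dot_mxE scalerA.
Qed.

Lemma refl_mx_orthogonal e : enorm e = 1 -> refl_mx e *m (refl_mx e)^T = 1%:M.
Proof.
move=> e1; have -> : (refl_mx e)^T = refl_mx e.
  by rewrite /refl_mx linearB linearZ /= trmx1 trmx_mul trmxK.
rewrite {2}/refl_mx mulmxBr mulmx1 -scalemxAr mulmxA.
rewrite (_ : refl_mx e *m e^T = - e^T); last first.
  rewrite /refl_mx mulmxBl mul1mx -scalemxAl -mulmxA [e *m e^T]mx11_scalar.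
  rewrite -dot_mxE -enorm_sqr e1 expr1n mulmx1.
  by rewrite scaler_nat mulr2n opprD addrA subrr sub0r.
by rewrite mulNmx scalerN opprK /refl_mx subrK.
Qed.

Lemma dot_refl_axis e u : enorm e = 1 -> dot (u *m refl_mx e) e = - dot u e.
Proof.
move=> e1; rewrite mulmx_refl dotBl dotZl -enorm_sqr e1; ring.
Qed.

Lemma enorm_refl e u : enorm e = 1 -> enorm (u *m refl_mx e) = enorm u.
Proof.
move=> e1; apply/eqP; rewrite -(@eqrXn2 _ 2)// ?enorm_ge0//.
rewrite mulmx_refl enorm_sqrB dotZr enormZ exprMn real_normK ?num_real// e1.
by apply/eqP; ring.
Qed.

Lemma dot_refl e u v : dot (u *m refl_mx e) v = dot u (v *m refl_mx e).
Proof. rewrite !mulmx_refl dotBl dotBr dotZl dotZr (dotC e v); ring. Qed.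

(** The reflection in the bisecting hyperplane of [e] and [e'] exchanges them. *)
Lemma refl_swap e e' : enorm e = 1 -> enorm e' = 1 ->
  exists2 Q : 'M[R]_d, Q *m Q^T = 1%:M & forall u, dot (u *m Q) e = dot u e'.
Proof.
move=> e1 e'1; have [ee'|ee'] := eqVneq e e'.
  by exists 1%:M => [|u]; rewrite ?trmx1 mulmx1 ?ee'.
have n0 : enorm (e - e') != 0 by rewrite enorm_eq0 subr_eq0.
exists (refl_mx ((enorm (e - e'))^-1 *: (e - e'))).
  apply: refl_mx_orthogonal.
  by rewrite enormZ ger0_norm ?invr_ge0 ?enorm_ge0// mulVf.
move=> u; rewrite dot_refl mulmx_refl dotZr scalerA.
rewrite (_ : _ * _ = 1) ?scale1r ?subKr//.
have : enorm (e - e') ^+ 2 = 2 * dot e (e - e').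
  by rewrite enorm_sqrB e1 e'1 dotBr -enorm_sqr e1; ring.
move=> h; transitivity (2 * dot e (e - e') / enorm (e - e') ^+ 2); first by field.
by rewrite -h divff// sqrf_eq0.
Qed.

End reflections.

Section uniform_sphere.
Context {R : realType} {d : nat}.
Variable mu : probability 'rV[R]_d R.
Hypothesis mu_unif : is_unif_sphere mu.
Implicit Types (e u y : 'rV[R]_d) (h : 'rV[R]_d -> R).

Lemma unif_sphere_ae : {ae mu, forall u, enorm u = 1}.
Proof.
have mS := @measurable_esphere R d.
exists (~` esphere); split; first exact: measurableC.
- by rewrite probability_setC// mu_unif.1 subee.
- by move=> u.
Qed.

Lemma measurable_mulmx (Q : 'M[R]_d) :
  measurable_fun setT (fun u : 'rV[R]_d => u *m Q).
Proof.
apply/measurable_rowP => i; under eq_fun do rewrite mxE.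
apply: measurable_sum => j; apply: measurable_funM => //.
exact: measurable_coord.
Qed.

Lemma unif_sphere_orthogonal (Q : 'M[R]_d) h : Q *m Q^T = 1%:M -> L1 mu h ->
  L1 mu (fun u => h (u *m Q)) /\ \int[mu]_u h (u *m Q) = \int[mu]_u h u.
Proof.
move=> QQ Lh; have mQ := measurable_mulmx Q.
have mh := L1_measurable Lh.
pose mphi := isMeasurableFun.Build _ _ _ _ _ mQ.
pose phi : {mfun _ >-> _} := HB.pack (fun u : 'rV[R]_d => u *m Q) mphi.
have pE A : measurable A -> pushforward mu phi A = mu A.
  by move=> mA; exact: mu_unif.2.
have LQ : L1 mu (fun u => h (u *m Q)).
  apply/integrableP; split; first exact/measurable_EFinP/measurableT_comp.
  rewrite -[ltLHS](@ge0_integral_pushforward _ _ _ _ _ phi _ mu setT (fun u => `|(h u)%:E|%E))//.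
    rewrite (@eq_measure_integral _ _ _ _ mu) /= => [|A mA _]; last exact: pE.
    by case/integrableP : Lh.
  by apply: measurableT_comp => //; exact/measurable_EFinP.
split=> //; congr fine.
rewrite -[RHS](@eq_measure_integral _ _ _ _ mu (pushforward mu phi)) => [|A mA _]; last exact: pE.
rewrite (integral_pushforward (phi := phi))//.
exact/measurable_EFinP.
Qed.

Hypothesis d_gt0 : (0 < d)%N.

Lemma L1_sphere h c : measurable_fun setT h ->
  (forall u, enorm u = 1 -> `|h u| <= c) -> L1 mu h.
Proof. by move=> mh hc; apply: (L1_bounded (c := c)) => //; apply: filterS unif_sphere_ae. Qed.

Lemma measurable_dotl e : measurable_fun setT (fun u => dot u e).
Proof. by apply: measurable_dot; [exact: measurable_id|exact: measurable_cst]. Qed.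

Lemma dot_sphere u e : enorm u = 1 -> `|dot u e| <= enorm e.
Proof. by move=> u1; rewrite (le_trans (cauchy_schwarz_abs _ _))// u1 mul1r. Qed.

Lemma L1_sphere_dot e : L1 mu (fun u => dot u e).
Proof. by apply: (L1_sphere (measurable_dotl e)) => u; exact: dot_sphere. Qed.

Lemma L1_sphere_dot2 e : L1 mu (fun u => dot u e ^+ 2).
Proof.
apply: (@L1_sphere _ (enorm e ^+ 2)).
  by apply: measurable_funX; exact: measurable_dotl.
by move=> u /(dot_sphere e) ue; rewrite normrX lerXn2r ?nnegrE ?enorm_ge0.
Qed.

(** The reflection along [e] changes the sign of [dot u e]. *)
Lemma unif_sphere_mean e : enorm e = 1 -> \int[mu]_u dot u e = 0.
Proof.
move=> e1.
have [_] := unif_sphere_orthogonal (refl_mx_orthogonal e1) (L1_sphere_dot e).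
under eq_Rintegral do rewrite dot_refl_axis// -mulN1r.
by rewrite expectZ; [lra|exact: L1_sphere_dot].
Qed.

(** Reflections act transitively on unit vectors, so that all directions have
    the same second moment; these moments add up to [1] over a basis. *)
Lemma unif_sphere_second_moment e : enorm e = 1 ->
  \int[mu]_u dot u e ^+ 2 = d%:R^-1.
Proof.
move=> e1.
have same i : \int[mu]_u dot u (delta_mx 0 i) ^+ 2 = \int[mu]_u dot u e ^+ 2.
  have [Q QQ Qe] := refl_swap e1 (enorm_delta i).
  have [_ <-] := unif_sphere_orthogonal QQ (L1_sphere_dot2 e).
  by apply: eq_Rintegral => u _; rewrite Qe.
have : \sum_(i < d) \int[mu]_u dot u (delta_mx 0 i) ^+ 2 = 1.
  rewrite -expect_sum; last by move=> i; exact: L1_sphere_dot2.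
  rewrite -[RHS](expect_cst mu); apply: expect_ae_eq => //.
    by apply: measurable_sum => i; apply: measurable_funX; exact: measurable_dotl.
  apply: filterS unif_sphere_ae => u u1.
  under eq_bigr do rewrite dot_deltar expr2.
  by rewrite -/(dot u u) -enorm_sqr u1 expr1n.
under eq_bigr do rewrite same.
have dn0 : d%:R != 0 :> R by rewrite pnatr_eq0 -lt0n.
by rewrite sumr_const card_ord => h; apply: (mulIf dn0); rewrite mulVf// mulr_natr.
Qed.

Section smoothed_gradient.
Variables (f : 'rV[R]_d -> R) (L delta : R).
Hypothesis f_lip : forall x y, `|f x - f y| <= L * enorm (x - y).
Hypotheses (L_gt0 : 0 < L) (delta_gt0 : 0 < delta).

(** The mean of the one-point estimator [d / delta * f (y + delta u) u]; by the
    divergence theorem it is the gradient at [y] of the average of [f] over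
    balls of radius [delta]. *)
Definition sgrad y : 'rV[R]_d :=
  \row_i (d%:R / delta * \int[mu]_u (f (y + delta *: u) * u 0 i)).

Lemma measurable_shift y : measurable_fun setT (fun u => f (y + delta *: u)).
Proof.
apply: (@lipschitz_measurable _ _ _ (L * delta)) => u v.
apply: le_trans (f_lip _ _) _.
rewrite opprD addrACA subrr add0r -scalerBr enormZ gtr0_norm//.
by rewrite mulrA.
Qed.

Lemma shift_bound y u : enorm u = 1 -> `|f (y + delta *: u)| <= `|f y| + L * delta.
Proof.
move=> u1; rewrite -lerBlDl; apply: le_trans (lerB_dist _ _) _.
by rewrite (le_trans (f_lip _ _))// addrC addKr enormZ u1 mulr1 gtr0_norm.
Qed.

Lemma L1_shift_dot y e : L1 mu (fun u => f (y + delta *: u) * dot u e).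
Proof.
apply: (@L1_sphere _ ((`|f y| + L * delta) * enorm e)).
  by apply: measurable_funM; [exact: measurable_shift|exact: measurable_dotl].
move=> u u1; rewrite normrM ler_pM//; [exact: shift_bound|exact: dot_sphere].
Qed.

Lemma dot_sgrad y e :
  dot (sgrad y) e = d%:R / delta * \int[mu]_u (f (y + delta *: u) * dot u e).
Proof.
have Li i : L1 mu (fun u => f (y + delta *: u) * u 0 i).
  by under eq_fun do rewrite -dot_deltar; exact: L1_shift_dot.
rewrite (@eq_Rintegral _ _ _ mu _ (fun u => \sum_i (e 0 i * (f (y + delta *: u) * u 0 i)))).
  rewrite expect_sum => [|i]; last exact: L1Z.
  rewrite mulr_sumr; apply: eq_bigr => i _.
  by rewrite expectZ// mxE; ring.
by move=> u _; rewrite mulr_sumr; apply: eq_bigr => i _; ring.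
Qed.

(** Unlike a Taylor expansion at [y], which loses a factor [sqrt d],
    antisymmetrising along [e] leaves a difference of values of [f] at two
    points that are only [2 delta |dot u e|] apart, and [dot u e ^+ 2] has mean
    [1 / d]. *)
Lemma dot_sgrad_bias (Lg : R) (f_diff : forall x, differentiable f x)
    (grad_lip : forall x y, enorm (grad f x - grad f y) <= Lg * enorm (x - y))
    (Lg_gt0 : 0 < Lg) y e : enorm e = 1 ->
  `|dot (sgrad y - grad f y) e| <= Lg * delta.
Proof.
move=> e1; set I := \int[mu]_u (f (y + delta *: u) * dot u e).
pose a := dot (grad f y) e.
pose D u := (f (y + delta *: u) - f (y + delta *: (u *m refl_mx e))) * dot u e.
have [LR IR] := unif_sphere_orthogonal (refl_mx_orthogonal e1) (L1_shift_dot y e).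
have LDE : (fun u => f (y + delta *: u) * dot u e +
    f (y + delta *: (u *m refl_mx e)) * dot (u *m refl_mx e) e) = D.
  by apply/funext => u; rewrite dot_refl_axis// /D; ring.
have LD : L1 mu D by rewrite -LDE; apply: L1D => //; exact: L1_shift_dot.
have ID : \int[mu]_u D u = 2 * I.
  by rewrite -LDE expectD ?IR//; [rewrite -/I; ring|exact: L1_shift_dot].
have near u : enorm u = 1 ->
    `|D u - 2 * delta * a * dot u e ^+ 2| <= 2 * Lg * delta ^+ 2 * dot u e ^+ 2.
  (* [w] joins the reflected point to the original one, along [e] *)
  move=> u1; pose w := (2 * delta * dot u e) *: e.
  have uw : y + delta *: u = y + delta *: (u *m refl_mx e) + w.
    by rewrite mulmx_refl /w scalerBr scalerA addrA mulrCA mulrA subrK.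
  rewrite /D uw; have [t t01 ->] := mean_value_grad f_diff (y + delta *: (u *m refl_mx e)) w.
  set p := y + _ + _.
  have py : enorm (p - y) <= delta.
    have -> : p - y = (1 - t) *: (delta *: (u *m refl_mx e)) + t *: (delta *: u).
      have -> : delta *: u = delta *: (u *m refl_mx e) + w.
        by apply: (addrI y); rewrite uw addrA.
      by apply/rowP => i; rewrite !mxE; ring.
    apply: le_trans (enormD _ _) _; rewrite !enormZ enorm_refl// u1 mulr1.
    move: t01 => /andP[t0 t1]; rewrite (gtr0_norm delta_gt0) !ger0_norm ?subr_ge0//.
    by rewrite -mulrDl subrK mul1r.
  have -> : dot (grad f p) w * dot u e - 2 * delta * a * dot u e ^+ 2 =
      2 * delta * dot u e ^+ 2 * dot (grad f p - grad f y) e.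
    by rewrite /w dotZr dotBl -/a; ring.
  have c0 : 0 <= 2 * delta * dot u e ^+ 2.
    by rewrite mulr_ge0 ?sqr_ge0// mulr_ge0// ltW.
  rewrite normrM ger0_norm//.
  rewrite [leRHS](_ : _ = 2 * delta * dot u e ^+ 2 * (Lg * delta)); last by ring.
  rewrite ler_wpM2l//.
  apply: le_trans (cauchy_schwarz_abs _ _) _; rewrite e1 mulr1.
  by apply: le_trans (grad_lip _ _) _; rewrite ler_wpM2l// ltW.
have dn0 : d%:R != 0 :> R by rewrite pnatr_eq0 -lt0n.
have Lq c := L1Z c (L1_sphere_dot2 e).
have Iq c : \int[mu]_u (c * dot u e ^+ 2) = c / d%:R.
  by rewrite expectZ ?unif_sphere_second_moment//; exact: L1_sphere_dot2.
have up : 2 * I - 2 * delta * a / d%:R <= 2 * Lg * delta ^+ 2 / d%:R.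
  rewrite -ID -!Iq -expectB//; apply: expect_ae_le => //; first exact: L1B.
  by apply: filterS unif_sphere_ae => u /near; rewrite ler_norml => /andP[].
have lo : - (2 * Lg * delta ^+ 2 / d%:R) <= 2 * I - 2 * delta * a / d%:R.
  rewrite -mulNr -ID -!Iq -expectB//; apply: expect_ae_le => //; first exact: L1B.
  by apply: filterS unif_sphere_ae => u /near; rewrite ler_norml mulNr => /andP[].
have -> : dot (sgrad y - grad f y) e = d%:R / (2 * delta) * (2 * I - 2 * delta * a / d%:R).
  by rewrite dotBl dot_sgrad -/I -/a; field; rewrite dn0 gt_eqF.
have -> : Lg * delta = d%:R / (2 * delta) * (2 * Lg * delta ^+ 2 / d%:R).
  by field; rewrite dn0 gt_eqF.
have c0 : 0 <= d%:R / (2 * delta) by rewrite divr_ge0// mulr_ge0// ltW.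
by rewrite normrM ger0_norm// ler_wpM2l// ler_norml lo.
Qed.

(** Test the bias against its own direction. *)
Lemma sgrad_bias (Lg : R) (f_diff : forall x, differentiable f x)
    (grad_lip : forall x y, enorm (grad f x - grad f y) <= Lg * enorm (x - y))
    (Lg_gt0 : 0 < Lg) y :
  enorm (sgrad y - grad f y) <= Lg * delta.
Proof.
set b := _ - _; have [b0|b0] := eqVneq (enorm b) 0.
  by rewrite b0 mulr_ge0 ?ltW.
have bgt0 : 0 < enorm b by rewrite lt_neqAle eq_sym b0 enorm_ge0.
have e1 : enorm ((enorm b)^-1 *: b) = 1.
  by rewrite enormZ ger0_norm ?invr_ge0 ?enorm_ge0// mulVf.
have := dot_sgrad_bias f_diff grad_lip Lg_gt0 y e1; rewrite -/b dotZr -enorm_sqr.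
by rewrite expr2 mulKf// ger0_norm ?enorm_ge0.
Qed.

(** Centering [f (y + delta u)] at [f y] costs nothing, because [u] has mean [0],
    and leaves values bounded by [L * delta]. *)
Lemma sgrad_le y : enorm (sgrad y) <= d%:R * L.
Proof.
set g := sgrad y; have [g0|g0] := eqVneq (enorm g) 0.
  by rewrite g0 mulr_ge0 // ltW.
have ggt0 : 0 < enorm g by rewrite lt_neqAle eq_sym g0 enorm_ge0.
pose e := (enorm g)^-1 *: g.
have e1 : enorm e = 1 by rewrite enormZ ger0_norm ?invr_ge0 ?enorm_ge0// mulVf.
have -> : enorm g = dot g e by rewrite dotZr -enorm_sqr expr2 mulKf.
rewrite dot_sgrad -(@ler_pM2l _ (delta / d%:R)) ?divr_gt0 ?ltr0n//.
rewrite (_ : _ * (_ * _) = \int[mu]_u (f (y + delta *: u) * dot u e)); last first.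
  by field; rewrite pnatr_eq0 -lt0n d_gt0 gt_eqF.
rewrite [leRHS](_ : _ = L * delta); last by field; rewrite pnatr_eq0 -lt0n d_gt0.
rewrite -[leLHS]subr0 -(mulr0 (f y)) -(unif_sphere_mean e1) -expectZ; last exact: L1_sphere_dot.
rewrite -expectB; [|exact: L1_shift_dot|apply: L1Z; exact: L1_sphere_dot].
rewrite -[leRHS](expect_cst mu); apply: expect_ae_le.
- by apply: L1B; [exact: L1_shift_dot|apply: L1Z; exact: L1_sphere_dot].
- exact: L1_cst.
apply: filterS unif_sphere_ae => u u1; rewrite -mulrBl.
apply: le_trans (ler_norm _) _; rewrite normrM -[leRHS]mulr1 ler_pM//.
  by rewrite (le_trans (f_lip _ _))// addrC addKr enormZ u1 mulr1 gtr0_norm.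
by rewrite -e1; exact: dot_sphere.
Qed.

Lemma measurable_sgrad : measurable_fun setT sgrad.
Proof.
apply/measurable_rowP => i.
have Li y : L1 mu (fun u => f (y + delta *: u) * u 0 i).
  by under eq_fun do rewrite -dot_deltar; exact: L1_shift_dot.
apply: (@lipschitz_measurable _ _ _ (d%:R / delta * L)) => x y.
rewrite !mxE -mulrBr -expectB// normrM ger0_norm ?divr_ge0 ?(ltW delta_gt0)//.
rewrite -[leRHS]mulrA ler_wpM2l ?divr_ge0 ?(ltW delta_gt0)//.
apply: le_trans (le_normr_Rintegral _ _) _ => //; first exact: L1B.
rewrite -[leRHS](expect_cst mu); apply: expect_ae_le.
- by apply: integrable_norm; exact: L1B.
- exact: L1_cst.
apply: filterS unif_sphere_ae => u u1; rewrite -mulrBl normrM -[leRHS]mulr1 ler_pM//.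
  by rewrite (le_trans (f_lip _ _))// opprD addrACA subrr addr0.
by rewrite -u1; exact: coord_le_enorm.
Qed.

End smoothed_gradient.
End uniform_sphere.

(** * Integration against a conditional law *)

Section kernel_precomposition.
Context {d0 d1 d2 : measure_display} {T0 : measurableType d0}
  {T1 : measurableType d1} {T2 : measurableType d2} {R : realType}.
Variables (k : R.-pker T1 ~> T2) (q : T0 -> T1).

Definition kprecomp (mq : measurable_fun setT q) (x : T0) :
  {measure set T2 -> \bar R} := k (q x).

Hypothesis mq : measurable_fun setT q.

Let measurable_kprecomp U : measurable U ->
  measurable_fun setT (kprecomp mq ^~ U).
Proof.
by move=> mU; exact: (measurableT_comp (measurable_kernel k _ mU)).
Qed.

HB.instance Definition _ := isKernel.Build _ _ _ _ _ (kprecomp mq)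
  measurable_kprecomp.

Let kprecomp_prob x : kprecomp mq x [set: T2] = 1%E.
Proof. exact: prob_kernel. Qed.

HB.instance Definition _ := Kernel_isProbability.Build _ _ _ _ _
  (kprecomp mq) kprecomp_prob.

End kernel_precomposition.

(** The law of [(W, Z)] is the mixture, over the sample point [p.2], of the
    images of [k (W p.2)] under [z |-> (W p.2, z)]. Composition of kernels asks for
    a parameter space besides [O]; it is [unit]. *)
Section joint_kernel.
Context {dO d1 d2 : measure_display} {O : measurableType dO}
  {T1 : measurableType d1} {T2 : measurableType d2} {R : realType}.
Variables (k : R.-pker T1 ~> T2) (W : O -> T1).

Definition kjoint (mW : measurable_fun setT W) (p : unit * O) :
  {measure set (T1 * T2) -> \bar R}.
Proof.
refine (pushforward (k (W p.2)) (pair (W p.2)) : {measure set _ -> \bar R}).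
exact: pair1_measurable.
Defined.

Hypothesis mW : measurable_fun setT W.

Let measurable_kjoint U : measurable U -> measurable_fun setT (kjoint mW ^~ U).
Proof.
move=> mU.
have h := @measurable_fun_xsection_finite_kernel _ _ _ _ R k U.
rewrite (_ : kjoint mW ^~ U = (fun x => k x (xsection U x)) \o (W \o snd)).
  by apply: measurableT_comp; [apply: h; rewrite inE|exact: measurableT_comp].
by apply/funext => p /=; rewrite /kjoint /pushforward xsectionE.
Qed.

HB.instance Definition _ := isKernel.Build _ _ _ _ _ (kjoint mW)
  measurable_kjoint.

Let kjoint_prob p : kjoint mW p setT = 1%E.
Proof. by change (k (W p.2) setT = 1%E); rewrite prob_kernel. Qed.

HB.instance Definition _ := Kernel_isProbability.Build _ _ _ _ _ (kjoint mW)
  kjoint_prob.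

Lemma integral_kjoint p (Phi : T1 * T2 -> \bar R) :
  measurable_fun setT Phi -> (forall x, 0 <= Phi x)%E ->
  (\int[kjoint mW p]_x Phi x = \int[k (W p.2)]_z Phi (W p.2, z))%E.
Proof.
by move=> mPhi Phi0; rewrite (ge0_integral_pushforward (pair1_measurable _)).
Qed.

End joint_kernel.

Section conditional_law.
Context {dO d1 d2 : measure_display} {O : measurableType dO}
  {T1 : measurableType d1} {T2 : measurableType d2} {R : realType}.
Variable P : probability O R.

(** Measurability for the sigma-algebra generated by [G] on the same carrier, so
    that closure properties of measurable functions apply to adapted ones. *)
Definition adapted {dT} {T : measurableType dT} (G : set_system O) (f : O -> T) :=
  measurable_fun setT (f : g_sigma_algebraType G -> T).

Lemma adapted_le {dT} {T : measurableType dT} (G H : set_system O) (f : O -> T) :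
  G `<=` <<s H >> -> adapted G f -> adapted H f.
Proof.
move=> GH mf _ B mB; have := mf measurableT B mB.
by apply: smallest_sub => //; exact: smallest_sigma_algebra.
Qed.

Lemma adapted_measurable {dT} {T : measurableType dT} (G : set_system O) (f : O -> T) :
  G `<=` measurable -> adapted G f -> measurable_fun setT f.
Proof.
move=> GH mf _ B mB; have := mf measurableT B mB.
by apply: smallest_sub => //; exact: sigma_algebra_measurable.
Qed.

Variables (G : set_system O) (W : O -> T1) (Z : O -> T2) (k : R.-pker T1 ~> T2).
Hypotheses (G_sigma : sigma_algebra setT G) (G_meas : G `<=` measurable).
Hypotheses (W_adapted : adapted G W) (Z_law : cond_law P G Z (fun w => k (W w))).

Let mW : measurable_fun setT W. Proof. exact: adapted_measurable W_adapted. Qed.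
Let mZ : measurable_fun setT Z. Proof. by case: Z_law. Qed.
Let mWZ : measurable_fun setT (fun w => (W w, Z w)).
Proof. exact: measurable_fun_pair. Qed.
Let WZ : {mfun O >-> (T1 * T2)%type} :=
  HB.pack (fun w => (W w, Z w)) (isMeasurableFun.Build _ _ _ _ _ mWZ).

Let base := kprobability (@measurable_cst _ _ unit _ setT (P : pprobability O R)).

Let joint_lawE U : measurable U ->
  pushforward P WZ U = kcomp base (kjoint k mW) tt U.
Proof.
apply: (measure_unique [set A `*` B | A in measurable & B in measurable] (fun=> setT)).
- exact: measurable_prod_measurableType.
- move=> _ _ [X1 mX1 [X2 mX2 <-]] [Y1 mY1 [Y2 mY2 <-]].
  exists (X1 `&` Y1); first exact: measurableI.
  by exists (X2 `&` Y2); [exact: measurableI|rewrite setXI].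
- by move=> _; exists setT => //; exists setT => //; rewrite setXTT.
- by rewrite bigcup_const.
- move=> _ [A mA [B mB <-]]; rewrite /pushforward /kcomp /=.
  transitivity (P (W @^-1` A `&` Z @^-1` B)).
    by congr (P _); apply/seteqP; split.
  rewrite Z_law.2//; last first.
    rewrite -(sigma_algebra_id G_sigma) -[X in <<s _ >> X]setTI.
    exact: W_adapted.
  rewrite integral_mkcond; apply: eq_integral => w _.
  rewrite /kjoint /pushforward /= patchE; case: ifPn => wA.
    congr (k (W w) _); apply/seteqP; split=> z //=; first by split=> //; rewrite inE in wA.
    by case.
  rewrite /pushforward (_ : _ @^-1` _ = set0) ?measure0//.
  by apply/seteqP; split=> z //= [Aw _]; move/negP: wA; apply; rewrite inE.
- move=> _; change (P setT < +oo)%E.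
  by rewrite probability_setT ltry.
Qed.

(** The law of [(W, Z)] and the mixture of the laws [k (W w)] agree on measurable
    rectangles by definition of a conditional law, hence everywhere. *)
Lemma cond_law_integral (Phi : T1 * T2 -> \bar R) :
  measurable_fun setT Phi -> (forall x, 0 <= Phi x)%E ->
  (\int[P]_w Phi (W w, Z w) = \int[P]_w \int[k (W w)]_z Phi (W w, z))%E.
Proof.
move=> mPhi Phi0.
transitivity (\int[pushforward P WZ]_x Phi x)%E.
  by rewrite (ge0_integral_pushforward (phi := WZ)).
rewrite (eq_measure_integral (mkcomp base (kjoint k mW) tt)) => [|A mA _]; last exact: joint_lawE.
apply: etrans (integral_kcomp base (kjoint k mW) tt Phi0 mPhi) _.
by apply: eq_integral => w _; exact: integral_kjoint.
Qed.

End conditional_law.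
Section conditional_expectation.
Context {dO d1 d2 : measure_display} {O : measurableType dO}
  {T1 : measurableType d1} {T2 : measurableType d2} {R : realType}.
Variables (P : probability O R) (G : set_system O).
Variables (W : O -> T1) (Z : O -> T2) (k : R.-pker T1 ~> T2).
Hypotheses (G_sigma : sigma_algebra setT G) (G_meas : G `<=` measurable).
Hypotheses (W_adapted : adapted G W) (Z_law : cond_law P G Z (fun w => k (W w))).

Let cond_law_expect_ge0 (Psi : T1 * T2 -> R) :
  measurable_fun setT Psi -> (forall x, 0 <= Psi x) ->
  L1 P (fun w => Psi (W w, Z w)) ->
  (forall x, (k x).-integrable setT (fun z => (Psi (x, z))%:E)) ->
  L1 P (fun w => \int[k (W w)]_z Psi (W w, z)) /\
  \int[P]_w (\int[k (W w)]_z Psi (W w, z)) = \int[P]_w Psi (W w, Z w).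
Proof.
move=> mPsi Psi0 LPsi kPsi.
have mPsiE : measurable_fun setT (fun x => (Psi x)%:E) by exact/measurable_EFinP.
have h := cond_law_integral G_sigma G_meas W_adapted Z_law mPsiE.
have {}h : (\int[P]_w (Psi (W w, Z w))%:E =
    \int[P]_w (\int[k (W w)]_z Psi (W w, z))%:E)%E.
  rewrite h; last by move=> x; rewrite lee_fin.
  apply: eq_integral => w _; rewrite fineK//.
  exact: integrable_fin_num.
split; last by rewrite /Rintegral h.
apply/integrableP; split.
  apply/measurable_EFinP; apply: (measurableT_comp (f := fine)) => //.
  apply: (measurableT_comp (f := fun x => (\int[k x]_z (Psi (x, z))%:E)%E)).
    by apply: (measurable_fun_integral_finite_kernel (fun x => (Psi x)%:E) k).
  exact: adapted_measurable W_adapted.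
rewrite (_ : (fun w => _) = (fun w => (\int[k (W w)]_z Psi (W w, z))%:E)); last first.
  by apply/funext => w /=; rewrite ger0_norm// Rintegral_ge0.
rewrite -h; have /integrableP[_] := LPsi.
by under eq_integral do rewrite /= ger0_norm//.
Qed.

(** The tower property, in the form used for the oracle noise ([h = 0]) and for
    the mean over the directions. *)
Lemma cond_law_expect (Phi : T1 * T2 -> R) (h : T1 -> R) :
  measurable_fun setT Phi -> L1 P (fun w => Phi (W w, Z w)) ->
  (forall x, (k x).-integrable setT (fun z => (Phi (x, z))%:E)) ->
  (forall x, \int[k x]_z Phi (x, z) = h x) ->
  \int[P]_w h (W w) = \int[P]_w Phi (W w, Z w).
Proof.
move=> mPhi LPhi kPhi kh.
(* positive and negative parts of [Phi] *)
pose p x := (`|Phi x| + Phi x) / 2; pose n x := (`|Phi x| - Phi x) / 2.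
have mN : measurable_fun setT (fun x => `|Phi x|) by exact: measurableT_comp.
have mp : measurable_fun setT p by apply: measurable_funM => //; exact: measurable_funD.
have mn : measurable_fun setT n by apply: measurable_funM => //; exact: measurable_funB.
have p0 x : 0 <= p x by rewrite divr_ge0// -lerBlDr sub0r -normrN ler_norm.
have n0 x : 0 <= n x by rewrite divr_ge0// subr_ge0 ler_norm.
have pn x : Phi x = p x - n x by rewrite /p /n; field.
have Ih d (T : measurableType d) (m : {measure set T -> \bar R}) (X : T -> R) :
    m.-integrable setT (EFin \o X) ->
    m.-integrable setT (fun x => ((`|X x| + X x) / 2)%:E) /\
    m.-integrable setT (fun x => ((`|X x| - X x) / 2)%:E).
  move=> mX; have mNX := integrable_norm mX.
  by split; under eq_fun do rewrite EFinM; apply: integrableZr => //;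
    [exact: (integrableD _ mNX mX)|exact: (integrableB _ mNX mX)].
have [Lp Ln] : L1 P (fun w => p (W w, Z w)) /\ L1 P (fun w => n (W w, Z w)) by exact: Ih.
have kp x : (k x).-integrable setT (fun z => (p (x, z))%:E) by case: (Ih _ _ _ _ (kPhi x)).
have kn x : (k x).-integrable setT (fun z => (n (x, z))%:E) by case: (Ih _ _ _ _ (kPhi x)).
have [Lkp Ep] := cond_law_expect_ge0 mp p0 Lp kp.
have [Lkn En] := cond_law_expect_ge0 mn n0 Ln kn.
under [RHS]eq_Rintegral do rewrite pn.
rewrite expectB// -Ep -En -expectB//; apply: eq_Rintegral => w _.
rewrite -kh -RintegralB//; apply: eq_Rintegral => z _.
exact: pn.
Qed.

End conditional_expectation.

(** * Oracle noise *)

Section oracle.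
Context {R : realType} {d : nat} {dX : measure_display} {X : measurableType dX}.
Variables (f : 'rV[R]_d -> R) (sigma : R).
Variables (Xi : R.-pker 'rV[R]_d ~> X) (F : 'rV[R]_d -> X -> R).
Hypothesis f_measurable : measurable_fun setT f.
Hypothesis F_measurable : measurable_fun setT (fun p : 'rV[R]_d * X => F p.1 p.2).
Hypothesis F_mean : forall x, (\int[Xi x]_z (F x z)%:E = (f x)%:E)%E.
Hypothesis F_variance : forall x,
  (\int[Xi x]_z (`|F x z - f x| ^+ 2)%:E <= (sigma ^+ 2)%:E)%E.

Let kernel_cst x (c : R) : (Xi x).-integrable setT (fun=> c%:E).
Proof.
apply/integrableP; split; first exact: measurable_cst.
by rewrite integral_cst// prob_kernel mule1 ltry.
Qed.

Let oracle_measurable x : measurable_fun setT (F x).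
Proof. exact: (measurableT_comp F_measurable (pair1_measurable x)). Qed.

(** Dominate [`|F x z|] by [`|f x| + 1 + `|F x z - f x| ^+ 2]. *)
Lemma oracle_integrable x : (Xi x).-integrable setT (fun z => (F x z)%:E).
Proof.
have sq : (Xi x).-integrable setT (fun z => (`|F x z - f x| ^+ 2)%:E).
  apply/integrableP; split.
    apply/measurable_EFinP/measurable_funX/measurableT_comp => //.
    exact: measurable_funB.
  apply: le_lt_trans (ltry (sigma ^+ 2)); apply: le_trans (F_variance x).
  by under eq_integral do rewrite gee0_abs ?lee_fin//.
have cst := kernel_cst x (`|f x| + 1).
apply: (le_integrable measurableT _ _ (integrableD measurableT cst sq)).
  exact/measurable_EFinP.
move=> z _; rewrite /= lee_fin; apply: le_trans (ler_norm _).
have : `|F x z| <= `|f x| + `|F x z - f x| by rewrite -{1}(subrKC (f x) (F x z)) ler_normD.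
have := sqr_ge0 (`|F x z - f x| - 1); have := normr_ge0 (F x z - f x).
rewrite sqrrB expr1n; lra.
Qed.

Section noise.
Context {dO : measure_display} {O : measurableType dO}.
Variables (P : probability O R) (G : set_system O).
Variables (q : O -> 'rV[R]_d) (Z : O -> X).
Hypotheses (G_sigma : sigma_algebra setT G) (G_meas : G `<=` measurable).
Hypotheses (q_adapted : adapted G q) (Z_law : cond_law P G Z (fun w => Xi (q w))).

Definition noise w := F (q w) (Z w) - f (q w).

Let noise_measurable : measurable_fun setT noise.
Proof.
have mq : measurable_fun setT q by exact: adapted_measurable q_adapted.
have mZ : measurable_fun setT Z by case: Z_law.
apply: measurable_funB; last exact: measurableT_comp.
exact: (measurableT_comp F_measurable (measurable_fun_pair mq mZ)).
Qed.

Lemma noise_variance : L2 P noise /\ \int[P]_w noise w ^+ 2 <= sigma ^+ 2.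
Proof.
pose Phi (p : 'rV[R]_d * X) := ((F p.1 p.2 - f p.1) ^+ 2)%:E.
have mPhi : measurable_fun setT Phi.
  apply/measurable_EFinP/measurable_funX/measurable_funB => //.
  exact: (measurableT_comp f_measurable measurable_fst).
have Phi0 p : (0 <= Phi p)%E by rewrite lee_fin sqr_ge0.
have E2 : (\int[P]_w (noise w ^+ 2)%:E <= (sigma ^+ 2)%:E)%E.
  have := cond_law_integral G_sigma G_meas q_adapted Z_law mPhi Phi0.
  rewrite /Phi /= => ->.
  apply: (@le_trans _ _ (\int[P]_w (sigma ^+ 2)%:E)%E).
    apply: ge0_le_integral => //.
    - by move=> w _; apply: integral_ge0 => z _; rewrite lee_fin sqr_ge0.
    - apply: (measurableT_comp (f := fun x => (\int[Xi x]_z Phi (x, z))%E)).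
        exact: (measurable_fun_integral_finite_kernel Phi Xi).
      exact: adapted_measurable q_adapted.
    - move=> w _; apply: le_trans (F_variance (q w)).
      by under [leRHS]eq_integral do rewrite real_normK ?num_real//.
  by rewrite integral_cst// [X in (_ * X)%E]probability_setT mule1.
have L : L1 P (fun w => noise w ^+ 2).
  apply/integrableP; split; first exact/measurable_EFinP/measurable_funX.
  apply: le_lt_trans (ltry (sigma ^+ 2)); apply: le_trans E2.
  by under eq_integral do rewrite gee0_abs ?lee_fin ?sqr_ge0//.
split; first by split.
by rewrite -lee_fin fineK// integrable_fin_num.
Qed.

Lemma noise_centered (c : O -> R) : adapted G c -> L2 P c ->
  \int[P]_w (c w * noise w) = 0.
Proof.
move=> Gc Lc; have [LN _] := noise_variance.
have mW : adapted G (fun w => (c w, q w)) by exact: measurable_fun_pair.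
have msnd : measurable_fun setT (snd : R * 'rV[R]_d -> 'rV[R]_d) by exact: measurable_snd.
pose k : R.-pker (R * 'rV[R]_d) ~> X := kprecomp Xi msnd.
have := @cond_law_expect _ _ _ _ _ _ _ P G (fun w => (c w, q w)) Z k
  G_sigma G_meas mW Z_law (fun p => p.1.1 * (F p.1.2 p.2 - f p.1.2)) (fun=> 0).
rewrite expect_cst => <-//.
- apply: measurable_funM.
    exact: (measurableT_comp measurable_fst measurable_fst).
  have m2 : measurable_fun setT (fun p : (R * 'rV[R]_d) * X => p.1.2).
    exact: (measurableT_comp measurable_snd measurable_fst).
  apply: measurable_funB; last exact: measurableT_comp.
  exact: (measurableT_comp F_measurable (measurable_fun_pair m2 measurable_snd)).
- exact: L2M.
- move=> x; apply: (integrableZl measurableT x.1 (f := fun z => (F x.2 z - f x.2)%:E)).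
  exact: (integrableB measurableT (oracle_integrable x.2) (kernel_cst x.2 (f x.2))).
- move=> x /=; rewrite /k/= /kprecomp RintegralZl//; last first.
    exact: (integrableB measurableT (oracle_integrable x.2) (kernel_cst x.2 (f x.2))).
  rewrite RintegralB//; [|exact: oracle_integrable|exact: kernel_cst].
  by rewrite {1}/Rintegral F_mean Rintegral_cst// prob_kernel /= mulr1 subrr mulr0.
Qed.

End noise.
End oracle.

(** * The filtration of a run *)

Section add_rv.
Context {dO dT : measure_display} {O : measurableType dO} {T : measurableType dT}.
Implicit Types (G H : set_system O) (Z : O -> T).

Lemma add_rv_sigma_algebra G Z : sigma_algebra setT (add_rv G Z).
Proof. exact: smallest_sigma_algebra. Qed.

Lemma sub_add_rv G Z : G `<=` add_rv G Z.
Proof. by move=> A GA; apply: sub_sigma_algebra; left. Qed.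

Lemma add_rv_measurable G Z : G `<=` measurable -> measurable_fun setT Z ->
  add_rv G Z `<=` measurable.
Proof.
move=> GH mZ; apply: smallest_sub; first exact: sigma_algebra_measurable.
by move=> _ [/GH//|[B mB <-]]; exact: mZ.
Qed.

Lemma adapted_add_rv G Z : adapted (add_rv G Z) Z.
Proof.
move=> _ B mB; apply: sub_sigma_algebra; apply: sub_sigma_algebra; right.
by exists B.
Qed.

Lemma adapted_sub {d'} {T' : measurableType d'} G H (h : O -> T') :
  G `<=` H -> adapted G h -> adapted H h.
Proof. by move=> GH; apply: adapted_le => A /GH; exact: sub_sigma_algebra. Qed.

End add_rv.

Section direction.
Context {dO d1 : measure_display} {O : measurableType dO} {T1 : measurableType d1}.
Context {R : realType} {d : nat}.
Variables (P : probability O R) (mu : probability 'rV[R]_d R).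

Lemma direction_expect (G : set_system O) (W : O -> T1) (u : O -> 'rV[R]_d)
    (Phi : T1 * 'rV[R]_d -> R) (h : T1 -> R) :
  sigma_algebra setT G -> G `<=` measurable ->
  adapted G W -> cond_law P G u (fun=> mu) ->
  measurable_fun setT Phi -> L1 P (fun w => Phi (W w, u w)) ->
  (forall x, L1 mu (fun z => Phi (x, z))) ->
  (forall x, \int[mu]_z Phi (x, z) = h x) ->
  \int[P]_w h (W w) = \int[P]_w Phi (W w, u w).
Proof.
move=> sG mG GW ulaw mPhi LPhi kPhi kh.
pose k : R.-pker T1 ~> 'rV[R]_d :=
  kprobability (@measurable_cst _ _ T1 _ setT (mu : pprobability 'rV[R]_d R)).
exact: (@cond_law_expect _ _ _ _ _ _ _ P G W u k sG mG GW ulaw Phi h).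
Qed.

End direction.

Section options.
Context {R : realType} {d : nat} {dX dO : measure_display}.
Context {X : measurableType dX} {O : measurableType dO}.
Variables (s : nat -> O -> R) (u : nat -> O -> 'rV[R]_d) (xi xi' : nat -> O -> X).

Lemma szo_optionP o : o = OptionI \/ o = OptionII.
Proof. by case: o; [left|right]. Qed.

Lemma match_optionI {A} (a b : A) o : o = OptionI ->
  (match o with OptionI => a | OptionII => b end) = a.
Proof. by move=> ->. Qed.

Lemma match_optionII {A} (a b : A) o : o = OptionII ->
  (match o with OptionI => a | OptionII => b end) = b.
Proof. by move=> ->. Qed.

Lemma history0I o : o = OptionI -> history o s u xi xi' 0 = [set set0; setT].
Proof. by move=> ->. Qed.

Lemma history0II o : o = OptionII ->
  history o s u xi xi' 0 = add_rv (add_rv [set set0; setT] (u 0)) (xi 0).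
Proof. by move=> ->. Qed.

Lemma historySI o t : o = OptionI -> history o s u xi xi' t.+1 =
  add_rv (add_rv (add_rv (add_rv (history o s u xi xi' t)
    (s t.+1)) (u t.+1)) (xi t.+1)) (xi' t.+1).
Proof. by move=> ->. Qed.

Lemma historySII o t : o = OptionII -> history o s u xi xi' t.+1 =
  add_rv (add_rv (add_rv (history o s u xi xi' t) (s t.+1)) (u t.+1)) (xi t.+1).
Proof. by move=> ->. Qed.

End options.

Section filtration.
Context {R : realType} {d : nat}.
Context {dX : measure_display} {X : measurableType dX}.
Context {dO : measure_display} {O : measurableType dO}.
Variables (P : probability O R) (mu : probability 'rV[R]_d R).
Variables (Xi : R.-pker 'rV[R]_d ~> X) (F : 'rV[R]_d -> X -> R).
Variables (opt : szo_option) (delta : R) (M K : nat) (eta : R).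
Hypothesis F_measurable : measurable_fun setT (fun p : 'rV[R]_d * X => F p.1 p.2).
Variable r : zo_o2nc_run P mu Xi F opt delta M K eta.
Hypotheses (M_gt0 : (0 < M)%N) (delta_gt0 : 0 < delta).

Local Notation H := (history opt (run_s r) (run_u r) (run_xi r) (run_xi' r)).

(** The sigma-algebras of what is known when [u_t], [xi_t] and [xi'_t],
    respectively, are drawn. *)
Definition pre_u t := add_rv (H t.-1) (run_s r t).
Definition pre_xi t :=
  if t is 0 then add_rv [set set0; setT] (run_u r 0) else add_rv (pre_u t) (run_u r t).
Definition pre_xi' t := add_rv (pre_xi t) (run_xi r t).

(** Iteration [0] draws [u_0] and [xi_0] under Option II only. *)
Definition is_sampled t : bool := (t <= K * M)%N && (if opt is OptionII then true else (0 < t)%N).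

Local Notation sampled := is_sampled.

Lemma sampledS t : (1 <= t <= K * M)%N -> sampled t.
Proof. by case/andP=> t0 tT; rewrite /is_sampled tT /=; case: opt. Qed.

Lemma trivial_measurable : [set set0; setT] `<=` @measurable dO O.
Proof. by move=> _ [->|->]; [exact: measurable0|exact: measurableT]. Qed.

Lemma history_measurable t : (t <= K * M)%N -> H t `<=` measurable.
Proof.
elim: t => [_|t IH tT].
  case: (szo_optionP opt) => o; first by rewrite (history0I _ _ _ _ o); exact: trivial_measurable.
  have [_ [mu0 _] [mx0 _]] := run_init r o.
  rewrite (history0II _ _ _ _ o).
  by apply: add_rv_measurable => //; apply: add_rv_measurable => //; exact: trivial_measurable.
have t1 : (1 <= t.+1 <= K * M)%N by [].
have [ms _] := run_s_law r t1; have [mu_ _] := run_u_law r t1.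
have [mx _] := run_xi_law r t1.
have mX : add_rv (add_rv (add_rv (H t) (run_s r t.+1)) (run_u r t.+1)) (run_xi r t.+1)
    `<=` measurable.
  by do 3!apply: add_rv_measurable => //; exact: IH (ltnW tT).
case: (szo_optionP opt) => o; last by rewrite (historySII _ _ _ _ _ o).
rewrite (historySI _ _ _ _ _ o); apply: add_rv_measurable => //.
by case: (run_xi'_law r o t1).
Qed.

Lemma pre_u_measurable t : (1 <= t <= K * M)%N -> pre_u t `<=` measurable.
Proof.
move=> tT; apply: add_rv_measurable; last by case: (run_s_law r tT).
by apply: history_measurable; case/andP: tT => _; exact/leq_trans/leq_pred.
Qed.

Lemma sampled_cases t : sampled t ->
  (t = 0%N /\ opt = OptionII) \/ (1 <= t <= K * M)%N.
Proof.
rewrite /is_sampled => /andP[tT]; case: t tT => [_|t tT _]; last by right.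
by case: (szo_optionP opt) => -> //; left.
Qed.

Lemma measurable_u t : sampled t -> measurable_fun setT (run_u r t).
Proof.
move=> /sampled_cases[[-> o]|tT]; last by case: (run_u_law r tT).
by have [_ [? _] _] := run_init r o.
Qed.

Lemma pre_xi_measurable t : sampled t -> pre_xi t `<=` measurable.
Proof.
move=> st; have mu_ := measurable_u st.
move: st => /sampled_cases[[t0 o]|].
  by rewrite t0 /= in mu_ *; apply: add_rv_measurable => //; exact: trivial_measurable.
case: t mu_ => // t mu_ tT; apply: add_rv_measurable => //; exact: pre_u_measurable.
Qed.

Lemma pre_xi_sigma t : sigma_algebra setT (pre_xi t).
Proof. by case: t => [|t]; exact: add_rv_sigma_algebra. Qed.

Lemma xi_law t : sampled t -> cond_law P (pre_xi t) (run_xi r t)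
  (fun w => Xi (run_y r t w + delta *: run_u r t w)).
Proof.
move=> /sampled_cases[[-> o]|]; first by have [_ _ ?] := run_init r o.
by case: t => // t tT; exact: (run_xi_law r tT).
Qed.

Lemma pre_xi'_history t : sampled t -> pre_xi' t `<=` H t.
Proof.
move=> /sampled_cases[[-> o]|]; first by rewrite (history0II _ _ _ _ o).
case: t => // t tT; case: (szo_optionP opt) => o; last by rewrite (historySII _ _ _ _ _ o).
rewrite (historySI _ _ _ _ _ o); exact: sub_add_rv.
Qed.

Lemma history_pre_u t : H t `<=` pre_u t.+1.
Proof. exact: sub_add_rv. Qed.

Lemma pre_u_pre_xi t : (0 < t)%N -> pre_u t `<=` pre_xi t.
Proof. by case: t => // t _; exact: sub_add_rv. Qed.

Lemma pre_xi_history t : sampled t -> pre_xi t `<=` H t.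
Proof.
by move=> st; apply: subset_trans (pre_xi'_history st); exact: sub_add_rv.
Qed.

Lemma pre_u_history t : (1 <= t <= K * M)%N -> pre_u t `<=` H t.
Proof.
move=> tT; apply: subset_trans (pre_xi_history (sampledS tT)).
by apply: pre_u_pre_xi; case/andP: tT.
Qed.

Lemma history_mono t t' : (t <= t' <= K * M)%N -> H t `<=` H t'.
Proof.
elim: t' => [|t' IH].
  by rewrite leqn0 => /andP[/eqP -> _] A.
rewrite leq_eqVlt => /andP[/predU1P[-> A//|tt'] tT].
move=> A HA; apply: pre_u_history => //; apply: history_pre_u.
by apply: IH HA; rewrite -ltnS tt' ltnW.
Qed.

Lemma u_adapted t : sampled t -> adapted (pre_xi t) (run_u r t).
Proof.
move=> /sampled_cases[[-> _]|]; first exact: adapted_add_rv.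
by case: t => // t _; exact: adapted_add_rv.
Qed.

Lemma adapted_oracle {G : set_system O} (q : O -> 'rV[R]_d) (z : O -> X) :
  adapted G q -> adapted G z -> adapted G (fun w => F (q w) (z w)).
Proof. by move=> Gq Gz; exact: (measurableT_comp F_measurable (measurable_fun_pair Gq Gz)). Qed.

(** [Delta_(t+1)] is computed from [Delta_t] and [g_t] at the end of iteration
    [t]: the induction over iterations has to carry it along. *)
Definition adapted_upto t : Prop :=
  [/\ adapted (H t) (run_x r t),
      (sampled t -> adapted (H t) (run_y r t)) &
      ((t < K * M)%N -> adapted (H t) (run_Delta r t.+1))].

(** [t.+2] either opens a block or continues the block of [t.+1]. *)
Lemma run_Delta_next t : (t.+1 < K * M)%N ->
  (forall w, run_Delta r t.+2 w = 0) \/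
  (forall w, is_eproj (eball 0 (delta / M%:R))
    (run_Delta r t.+1 w - eta *: run_g r t.+1 w) (run_Delta r t.+2 w)).
Proof.
move=> tT; have tE := divn_eq t M.
have mM := ltn_pmod t M_gt0.
have kK : (t %/ M < K)%N by rewrite ltn_divLR// (leq_trans _ tT)// leqW.
have [mM'|mM'] := ltnP (t %% M).+1 M.
  right=> w; have -> : t.+1 = (t %/ M * M + (t %% M).+1)%N by rewrite addnS -tE.
  exact: run_Delta_update.
have {mM'}mE : (t %% M).+1 = M by apply/eqP; rewrite eqn_leq mM mM'.
have {}tE : t.+1 = ((t %/ M).+1 * M)%N by rewrite {1}tE -addnS mE mulSn addnC.
left=> w; rewrite tE; apply: run_Delta_reset.
by rewrite -(ltn_pmul2r M_gt0) -tE.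
Qed.

Lemma run_gI t : opt = OptionI -> (1 <= t <= K * M)%N -> forall w,
  run_g r t w = (d%:R / (2 * delta) *
      (F (run_y r t w + delta *: run_u r t w) (run_xi r t w)
       - F (run_y r t w - delta *: run_u r t w) (run_xi' r t w)))
    *: run_u r t w.
Proof. by move=> o tT w; rewrite run_gE// (match_optionI _ _ o). Qed.

Lemma run_gII t : opt = OptionII -> (1 <= t <= K * M)%N -> forall w,
  run_g r t w = (d%:R / delta *
      (F (run_y r t w + delta *: run_u r t w) (run_xi r t w)
       - F (run_y r t.-1 w + delta *: run_u r t.-1 w) (run_xi r t.-1 w)))
    *: run_u r t w.
Proof. by move=> o tT w; rewrite run_gE// (match_optionII _ _ o). Qed.

Lemma xi_adapted t : sampled t -> adapted (H t) (run_xi r t).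
Proof. by move=> st; apply: adapted_sub (pre_xi'_history st) _; exact: adapted_add_rv. Qed.

Lemma adapted_scalar_cst {G : set_system O} {dT} {T : measurableType dT} (a : T) :
  adapted G (fun=> a).
Proof. exact: measurable_cst. Qed.

Let run_adapted_g t : (t <= K * M)%N ->
  adapted_upto t /\ ((0 < t)%N -> adapted (H t) (run_g r t)).
Proof.
elim: t => [_|t IH tT].
  split=> //; split.
  - rewrite (_ : run_x r 0 = fun=> 0); first exact: adapted_scalar_cst.
    by apply/funext => w; exact: run_x0.
  - move=> /sampled_cases[[_ o]|//].
    have [y0 _ _] := run_init r o.
    by rewrite (_ : run_y r 0 = fun=> 0); [exact: adapted_scalar_cst|exact/funext].
  - move=> T0; have K0 : (0 < K)%N by move: T0; rewrite muln_gt0 => /andP[].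
    rewrite (_ : run_Delta r 1 = fun=> 0); first exact: adapted_scalar_cst.
    by apply/funext => w; exact: (run_Delta_reset r K0).
have t1 : (1 <= t.+1 <= K * M)%N by [].
have [[Ax Ay AD] _] := IH (ltnW tT); have {}AD := AD tT.
have Ht : H t `<=` H t.+1 by apply: history_mono; rewrite leqnSn.
have st := sampledS t1.
have AS : adapted (H t.+1) (run_s r t.+1).
  by apply: adapted_sub (pre_u_history t1) _; exact: adapted_add_rv.
have AU : adapted (H t.+1) (run_u r t.+1).
  by apply: adapted_sub (pre_xi_history st) _; exact: u_adapted.
have AX := xi_adapted st.
have {}Ax := adapted_sub Ht Ax; have {}AD := adapted_sub Ht AD.
have Ay1 : adapted (H t.+1) (run_y r t.+1).
  rewrite (_ : run_y r _ = fun w => run_x r t w + run_s r t.+1 w *: run_Delta r t.+1 w).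
    by apply: measurable_rowD => //; exact: measurable_rowZ.
  by apply/funext => w; rewrite run_yE.
have Adu : adapted (H t.+1) (fun w => delta *: run_u r t.+1 w).
  by apply: measurable_rowZ => //; exact: measurable_cst.
have Aplus : adapted (H t.+1) (fun w => F (run_y r t.+1 w + delta *: run_u r t.+1 w) (run_xi r t.+1 w)).
  by apply: adapted_oracle => //; exact: measurable_rowD.
have Ag : adapted (H t.+1) (run_g r t.+1).
  case: (szo_optionP opt) => o.
    rewrite (funext (run_gI o t1)); apply: measurable_rowZ => //.
    apply: measurable_funM; first exact: measurable_cst.
    apply: measurable_funB => //; apply: adapted_oracle.
      exact: measurable_rowB.
    by rewrite (historySI _ _ _ _ _ o); exact: adapted_add_rv.
  rewrite (funext (run_gII o t1)); apply: measurable_rowZ => //.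
  apply: measurable_funM; first exact: measurable_cst.
  have st' : sampled t by rewrite /is_sampled (ltnW tT) o.
  apply: measurable_funB => //; apply: adapted_oracle.
    apply: measurable_rowD; first exact: adapted_sub Ht (Ay st').
    apply: measurable_rowZ; first exact: measurable_cst.
    apply: adapted_sub Ht _; apply: adapted_sub (pre_xi_history st') _.
    exact: u_adapted.
  exact: adapted_sub Ht (xi_adapted st').
split=> //; split=> //.
  rewrite (_ : run_x r _ = fun w => run_x r t w + run_Delta r t.+1 w).
    exact: measurable_rowD.
  by apply/funext => w; rewrite run_xE.
move=> /run_Delta_next[D0|Dp].
  by rewrite (funext D0); exact: adapted_scalar_cst.
have D_gt0 : 0 < delta / M%:R by rewrite divr_gt0 ?ltr0n.
rewrite (funext (fun w => eproj_eballE D_gt0 (Dp w))).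
have Az : adapted (H t.+1) (fun w => run_Delta r t.+1 w - eta *: run_g r t.+1 w).
  by apply: measurable_rowB => //; apply: measurable_rowZ => //; exact: measurable_cst.
apply: measurable_rowZ => //; exact: (measurableT_comp (measurable_eproj_factor D_gt0)).
Qed.

Lemma run_adapted t : (t <= K * M)%N -> adapted_upto t.
Proof. by move=> /run_adapted_g[]. Qed.

Lemma run_g_adapted t : (1 <= t <= K * M)%N -> adapted (H t) (run_g r t).
Proof. by case/andP => t0 /run_adapted_g[_]; exact. Qed.

End filtration.

(** * Moments and conditional means of the gradient estimators *)

Lemma cond_law_cst_ae {dO dT : measure_display} {O : measurableType dO}
    {T : measurableType dT} {R : realType} (P : probability O R)
    (G : set_system O) (Z : O -> T) (nu : set T -> \bar R) (B : set T) :
  G setT -> cond_law P G Z (fun=> nu) -> measurable B -> nu B = 1%E ->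
  {ae P, forall w, B (Z w)}.
Proof.
move=> GT [mZ lawZ] mB nuB.
have mZB : measurable (Z @^-1` B) by rewrite -[X in measurable X]setTI; exact: mZ.
have PZB : P (Z @^-1` B) = 1%E.
  by rewrite -[Z @^-1` B]setTI lawZ// nuB integral_cst// mul1e; exact: probability_setT.
exists (~` (Z @^-1` B)); split; first exact: measurableC.
- by rewrite probability_setC// PZB subee.
- by move=> w.
Qed.

Lemma sigma_algebra_setT {T : Type} (G : set_system T) : sigma_algebra setT G -> G setT.
Proof. by case=> G0 GC _; rewrite -(setD0 setT); exact: GC. Qed.

Lemma enorm_sqr_sum {R : realType} {d : nat} (v : 'rV[R]_d) :
  enorm v ^+ 2 = \sum_i v 0 i ^+ 2.
Proof. by rewrite enorm_sqr; apply: eq_bigr => i _; rewrite expr2. Qed.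

Lemma sqr_sum3_le {R : realType} (a b c : R) :
  (a + b + c) ^+ 2 <= 3 * (a ^+ 2 + b ^+ 2 + c ^+ 2).
Proof.
have := sqr_ge0 (a - b); have := sqr_ge0 (a - c); have := sqr_ge0 (b - c).
rewrite !sqrrB !expr2; lra.
Qed.

Section gradient_estimator.
Context {R : realType} {d : nat}.
Context {dX : measure_display} {X : measurableType dX}.
Context {dO : measure_display} {O : measurableType dO}.
Variables (P : probability O R) (mu : probability 'rV[R]_d R).
Variables (Xi : R.-pker 'rV[R]_d ~> X) (F : 'rV[R]_d -> X -> R).
Variables (opt : szo_option) (delta : R) (M K : nat) (eta : R).
Variables (f : 'rV[R]_d -> R) (sigma L : R).
Hypothesis d_gt0 : (0 < d)%N.
Hypothesis mu_unif : is_unif_sphere mu.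
Hypothesis f_lip : forall x y, `|f x - f y| <= L * enorm (x - y).
Hypothesis F_measurable : measurable_fun setT (fun p : 'rV[R]_d * X => F p.1 p.2).
Hypothesis F_mean : forall x, (\int[Xi x]_z (F x z)%:E = (f x)%:E)%E.
Hypothesis F_variance : forall x,
  (\int[Xi x]_z (`|F x z - f x| ^+ 2)%:E <= (sigma ^+ 2)%:E)%E.
Hypotheses (M_gt0 : (0 < M)%N) (delta_gt0 : 0 < delta) (L_gt0 : 0 < L).
Variable r : zo_o2nc_run P mu Xi F opt delta M K eta.

Local Notation H := (history opt (run_s r) (run_u r) (run_xi r) (run_xi' r)).
Local Notation x := (run_x r).
Local Notation y := (run_y r).
Local Notation u := (run_u r).
Local Notation Delta := (run_Delta r).
Local Notation g := (run_g r).
Local Notation sampled := (is_sampled opt M K).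
Local Notation D := (delta / M%:R).

Let f_measurable : measurable_fun setT f.
Proof. exact: lipschitz_measurable f_lip. Qed.

Lemma step_radius_gt0 : 0 < D. Proof. by rewrite divr_gt0// ltr0n. Qed.

Lemma step_radius_le : D <= delta.
Proof. by rewrite ler_pdivrMr ?ltr0n// ler_peMr ?(ltW delta_gt0)// ler1n. Qed.

Lemma history_setT t : H t setT.
Proof.
case: (szo_optionP opt) => o; case: t => [|t].
- by rewrite (history0I _ _ _ _ o); right.
- by rewrite (historySI _ _ _ _ _ o); apply: sigma_algebra_setT; exact: add_rv_sigma_algebra.
- by rewrite (history0II _ _ _ _ o); apply: sigma_algebra_setT; exact: add_rv_sigma_algebra.
- by rewrite (historySII _ _ _ _ _ o); apply: sigma_algebra_setT; exact: add_rv_sigma_algebra.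
Qed.

Lemma s_ae t : (1 <= t <= K * M)%N -> {ae P, forall w, 0 <= run_s r t w <= 1}.
Proof.
move=> tT; have := cond_law_cst_ae (T := measurableTypeR R) (B := `[0 : R, 1]%classic) (history_setT t.-1)
  (run_s_law r tT) (measurable_itv _).
rewrite /uniform_prob integral_uniform_pdf1// => /(_ erefl).
by apply: filterS => w /=; rewrite in_itv.
Qed.

Lemma u_ae t : sampled t -> {ae P, forall w, enorm (u t w) = 1}.
Proof.
have mS := @measurable_esphere R d.
move=> /sampled_cases[[-> o]|tT].
  have [_ ulaw _] := run_init r o.
  by apply: (cond_law_cst_ae _ ulaw mS mu_unif.1); right.
apply: (cond_law_cst_ae _ (run_u_law r tT) mS mu_unif.1).
by apply: sigma_algebra_setT; exact: add_rv_sigma_algebra.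
Qed.

Lemma Delta_bound t : (1 <= t <= K * M)%N -> forall w, enorm (Delta t w) <= D.
Proof.
case: t => [//|[|t]] tT w.
  have K0 : (0 < K)%N by case: (K) tT.
  by have := run_Delta_reset r K0 w; rewrite mul0n => ->; rewrite enorm0 ltW ?step_radius_gt0.
have [->|Dp] := run_Delta_next r M_gt0 tT; first by rewrite enorm0 ltW ?step_radius_gt0.
by have [] := Dp w; rewrite /eball /= subr0.
Qed.

Lemma Delta_adapted t : (1 <= t <= K * M)%N -> adapted (pre_u r t) (Delta t).
Proof.
case: t => // t tT; have [_ _ AD] := run_adapted F_measurable r M_gt0 delta_gt0 (ltnW tT).
by apply: adapted_sub (AD tT); exact: sub_add_rv.
Qed.

Lemma y_adapted t : (1 <= t <= K * M)%N -> adapted (pre_u r t) (y t).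
Proof.
case: t => // t tT; have [Ax _ _] := run_adapted F_measurable r M_gt0 delta_gt0 (ltnW tT).
rewrite (_ : y _ = fun w => x t w + run_s r t.+1 w *: Delta t.+1 w).
  apply: measurable_rowD; first by apply: adapted_sub Ax; exact: sub_add_rv.
  by apply: measurable_rowZ; [exact: adapted_add_rv|exact: Delta_adapted].
by apply/funext => w; rewrite run_yE.
Qed.

Lemma query_adapted (a : R) t : sampled t ->
  adapted (pre_xi r t) (fun w => y t w + a *: u t w).
Proof.
move=> st; apply: measurable_rowD; last first.
  by apply: measurable_rowZ; [exact: measurable_cst|exact: u_adapted].
move: st => /sampled_cases[[-> o]|tT].
  have [y0 _ _] := run_init r o; rewrite (funext y0); exact: measurable_cst.
apply: adapted_sub (y_adapted tT); apply: pre_u_pre_xi.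
by case/andP: tT.
Qed.

Definition noise_plus t := noise f F (fun w => y t w + delta *: u t w) (run_xi r t).
Definition noise_minus t := noise f F (fun w => y t w - delta *: u t w) (run_xi' r t).

Lemma noise_plus_variance t : sampled t ->
  L2 P (noise_plus t) /\ \int[P]_w noise_plus t w ^+ 2 <= sigma ^+ 2.
Proof.
move=> st; exact: (noise_variance f_measurable F_measurable F_variance
  (pre_xi_sigma r t) (pre_xi_measurable st) (query_adapted delta st) (xi_law r st)).
Qed.

Lemma noise_plus_centered t c : sampled t -> adapted (pre_xi r t) c -> L2 P c ->
  \int[P]_w (c w * noise_plus t w) = 0.
Proof.
move=> st; exact: (noise_centered f_measurable F_measurable F_mean F_variance
  (pre_xi_sigma r t) (pre_xi_measurable st) (query_adapted delta st) (xi_law r st)).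
Qed.

Section option1.
Hypothesis o : opt = OptionI.

Let pre_xi'_measurable t : (1 <= t <= K * M)%N -> pre_xi' r t `<=` measurable.
Proof.
move=> tT; apply: add_rv_measurable; last by case: (run_xi_law r tT).
by apply: pre_xi_measurable; exact: sampledS.
Qed.

Let query_minus_adapted t : (1 <= t <= K * M)%N ->
  adapted (pre_xi' r t) (fun w => y t w - delta *: u t w).
Proof.
move=> tT; under eq_fun do rewrite -scaleNr.
apply: adapted_sub (query_adapted (- delta) (sampledS _ tT)); exact: sub_add_rv.
Qed.

Let xi'_law t : (1 <= t <= K * M)%N -> cond_law P (pre_xi' r t) (run_xi' r t)
  (fun w => Xi (y t w - delta *: u t w)).
Proof. by case: t => // t tT; exact: (run_xi'_law r o tT). Qed.

Lemma noise_minus_variance t : (1 <= t <= K * M)%N ->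
  L2 P (noise_minus t) /\ \int[P]_w noise_minus t w ^+ 2 <= sigma ^+ 2.
Proof.
move=> st; exact: (noise_variance f_measurable F_measurable F_variance
  (add_rv_sigma_algebra _ _) (pre_xi'_measurable st) (query_minus_adapted st) (xi'_law st)).
Qed.

Lemma noise_minus_centered t c : (1 <= t <= K * M)%N -> adapted (pre_xi' r t) c ->
  L2 P c -> \int[P]_w (c w * noise_minus t w) = 0.
Proof.
move=> st; exact: (noise_centered f_measurable F_measurable F_mean F_variance
  (add_rv_sigma_algebra _ _) (pre_xi'_measurable st) (query_minus_adapted st) (xi'_law st)).
Qed.

End option1.

Lemma g_adapted t : (1 <= t <= K * M)%N -> adapted (H t) (g t).
Proof.
exact: run_g_adapted.
Qed.

Lemma g_measurable t : (1 <= t <= K * M)%N -> measurable_fun setT (g t).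
Proof.
move=> tT; apply: adapted_measurable (g_adapted tT); apply: history_measurable.
by case/andP: tT.
Qed.

(** The increment is a combination of [Delta_(t-1)] and [Delta_t] with weights in
    [[0, 1]]; at [t = 1] it is [s_1 Delta_1], as [y_0 = x_0 = 0]. *)
Lemma y_step t : opt = OptionII -> (1 <= t <= K * M)%N ->
  {ae P, forall w, enorm (y t w - y t.-1 w) <= 2 * delta}.
Proof.
move=> o; have DD := step_radius_le; have D0 := ltW step_radius_gt0.
have sD (a : R) (v : 'rV[R]_d) : 0 <= a <= 1 -> enorm v <= D -> enorm (a *: v) <= delta.
  move=> /andP[a0 a1] vD; rewrite enormZ ger0_norm//; apply: le_trans DD.
  by rewrite -[leRHS]mul1r ler_pM// enorm_ge0.
case: t => [//|[|t]] tT.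
  have [y0 _ _] := run_init r o.
  apply: filterS (s_ae tT) => w sw; rewrite y0 subr0 run_yE//= run_x0 add0r.
  by apply: le_trans (sD _ _ sw (Delta_bound tT w)) _; lra.
have t1 : (1 <= t.+1 <= K * M)%N by rewrite (ltnW (andP tT).2).
apply: filterS2 (s_ae tT) (s_ae t1) => w sw sw'.
rewrite run_yE//= run_xE//= run_yE//=.
rewrite (_ : _ - _ = (1 - run_s r t.+1 w) *: Delta t.+1 w + run_s r t.+2 w *: Delta t.+2 w); last first.
  by apply/rowP => i; rewrite !mxE; ring.
apply: le_trans (enormD _ _) _; rewrite [2 * _]mulr_natl mulr2n lerD//.
  by apply: sD (Delta_bound t1 w); move/andP: sw' => [? ?]; rewrite subr_ge0; lra.
exact: sD sw (Delta_bound tT w).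
Qed.

Let two_query_dist v v1 z z1 : enorm z = 1 -> enorm z1 = 1 ->
  enorm (v - v1) <= 2 * delta ->
  `|f (v + delta *: z) - f (v1 + delta *: z1)| <= 4 * L * delta.
Proof.
move=> nz nz1 vv; apply: le_trans (f_lip _ _) _.
rewrite (_ : 4 * L * delta = L * (2 * delta + (delta + delta))); last by ring.
rewrite ler_wpM2l ?(ltW L_gt0)// opprD addrACA.
apply: le_trans (enormD _ _) _; rewrite lerD//.
apply: le_trans (enormB _ _) _; rewrite !enormZ nz nz1 mulr1 ger0_norm//.
exact: ltW.
Qed.

(** Each estimator is [d / delta] times a difference of two oracle values: two
    noises, plus a difference of values of [f] at points at distance at most
    [4 delta]. *)
Lemma g_pathwise t : (1 <= t <= K * M)%N -> exists N1 N2 : O -> R,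
  [/\ L2 P N1 /\ \int[P]_w N1 w ^+ 2 <= sigma ^+ 2,
      L2 P N2 /\ \int[P]_w N2 w ^+ 2 <= sigma ^+ 2 &
      {ae P, forall w, enorm (g t w) ^+ 2 <=
        3 * (d%:R / delta) ^+ 2 * (N1 w ^+ 2 + N2 w ^+ 2 + (4 * L * delta) ^+ 2)}].
Proof.
move=> tT; have st := sampledS opt tT; have du0 := ltW delta_gt0; have L0 := ltW L_gt0.
have nu w : enorm (u t w) = 1 -> enorm (delta *: u t w) = delta.
  by move=> uw; rewrite enormZ uw mulr1 ger0_norm.
have sq3 a n1 n2 e b : 0 <= a -> a <= d%:R / delta -> `|e| <= b ->
    (a * (n1 + n2 + e)) ^+ 2 <= 3 * (d%:R / delta) ^+ 2 * (n1 ^+ 2 + n2 ^+ 2 + b ^+ 2).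
  move=> a0 ad eb.
  rewrite exprMn [leRHS](_ : _ = (d%:R / delta) ^+ 2 *
    (3 * (n1 ^+ 2 + n2 ^+ 2 + b ^+ 2))); last by ring.
  rewrite ler_pM ?sqr_ge0//; first by rewrite lerXn2r ?nnegrE// (le_trans a0).
  apply: le_trans (sqr_sum3_le _ _ _) _; rewrite ler_wpM2l// lerD2l.
  by rewrite -real_normK ?num_real// lerXn2r ?nnegrE ?(le_trans (normr_ge0 e)).
case: (szo_optionP opt) => o.
  exists (noise_plus t), (fun w => - noise_minus t w); split.
  - exact: noise_plus_variance.
  - have [LN EN] := noise_minus_variance o tT; split.
      by under eq_fun do rewrite -mulN1r; exact: L2Z.
    by under eq_Rintegral do rewrite sqrrN.
  apply: filterS (u_ae st) => w uw; rewrite run_gI// enormZ uw mulr1 real_normK ?num_real//.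
  rewrite (_ : F _ _ - F _ _ = noise_plus t w - noise_minus t w +
    (f (y t w + delta *: u t w) - f (y t w - delta *: u t w))); last first.
    by rewrite /noise_plus /noise_minus /noise; ring.
  apply: sq3.
  - by rewrite divr_ge0// mulr_ge0.
  - rewrite ler_pM2l ?ltr0n// lef_pV2 ?posrE ?mulr_gt0//; lra.
  apply: le_trans (f_lip _ _) _.
  rewrite (_ : _ - _ = delta *: u t w + delta *: u t w); last first.
    by apply/rowP => i; rewrite !mxE; ring.
  rewrite (_ : 4 * L * delta = L * (2 * delta + 2 * delta)); last by ring.
  rewrite ler_wpM2l//; apply: le_trans (enormD _ _) _; rewrite nu//; lra.
have st1 : sampled t.-1.
  by rewrite /is_sampled o (leq_trans (leq_pred t))//; case/andP: tT.
exists (noise_plus t), (fun w => - noise_plus t.-1 w); split.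
- exact: noise_plus_variance.
- have [LN EN] := noise_plus_variance st1; split.
    by under eq_fun do rewrite -mulN1r; exact: L2Z.
  by under eq_Rintegral do rewrite sqrrN.
apply: filterS3 (u_ae st) (u_ae st1) (y_step o tT) => w uw uw1 yw.
rewrite run_gII// enormZ uw mulr1 real_normK ?num_real//.
rewrite (_ : F _ _ - F _ _ = noise_plus t w - noise_plus t.-1 w +
  (f (y t w + delta *: u t w) - f (y t.-1 w + delta *: u t.-1 w))); last first.
  by rewrite /noise_plus /noise; ring.
apply: sq3 => //; first by rewrite divr_ge0.
exact: two_query_dist.
Qed.

Lemma g_second_moment t : (1 <= t <= K * M)%N ->
  L1 P (fun w => enorm (g t w) ^+ 2) /\
  \int[P]_w enorm (g t w) ^+ 2 <=
    d%:R ^+ 2 * (6 * sigma ^+ 2 / delta ^+ 2 + 48 * L ^+ 2).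
Proof.
move=> tT; have [N1 [N2 [[LN1 E1] [LN2 E2] gN]]] := g_pathwise tT.
have mg : measurable_fun setT (fun w => enorm (g t w) ^+ 2).
  apply: measurable_funX; exact: (measurableT_comp measurable_enorm (g_measurable tT)).
have LS : L1 P (fun w => N1 w ^+ 2 + N2 w ^+ 2 + (4 * L * delta) ^+ 2).
  by apply: L1D; [apply: L1D; [case: LN1|case: LN2]|exact: L1_cst].
have LB := L1Z (3 * (d%:R / delta) ^+ 2) LS.
have Lg : L1 P (fun w => enorm (g t w) ^+ 2).
  by apply: L1_le mg LB _; apply: filterS gN => w; rewrite ger0_norm ?sqr_ge0.
split=> //; apply: le_trans (expect_ae_le Lg LB gN) _.
rewrite expectZ// expectD; [|by apply: L1D; [case: LN1|case: LN2]|exact: L1_cst].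
rewrite expectD; [|by case: LN1|by case: LN2].
rewrite expect_cst [leRHS](_ : _ = 3 * (d%:R / delta) ^+ 2 *
    (sigma ^+ 2 + sigma ^+ 2 + (4 * L * delta) ^+ 2)); last first.
  by field; rewrite gt_eqF.
apply: ler_wpM2l; first by rewrite mulr_ge0 ?sqr_ge0.
by rewrite lerD2r lerD.
Qed.

Local Notation G := (sgrad mu f delta).

Let coord_u_ae t i : sampled t -> {ae P, forall w, `|u t w 0 i| <= 1}.
Proof.
by move=> st; apply: filterS (u_ae st) => w <-; exact: coord_le_enorm.
Qed.

Let measurable_shift2 dT (T : measurableType dT) (a : R) (q v : T -> 'rV[R]_d) :
  measurable_fun setT q -> measurable_fun setT v ->
  measurable_fun setT (fun w => f (q w + a *: v w)).
Proof.
move=> mq mv; apply: (measurableT_comp f_measurable).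
by apply: measurable_rowD => //; apply: measurable_rowZ => //; exact: measurable_cst.
Qed.

Let measurable_coord_comp dT (T : measurableType dT) (v : T -> 'rV[R]_d) i :
  measurable_fun setT v -> measurable_fun setT (fun w => v w 0 i).
Proof. by move=> mv; exact: (measurableT_comp (measurable_coord i)). Qed.

Let L1_mu_shift q i : L1 mu (fun z => f (q + delta *: z) * z 0 i).
Proof.
by under eq_fun do rewrite -dot_deltar; exact: (L1_shift_dot mu_unif f_lip delta_gt0).
Qed.

Let mean_shift q i : \int[mu]_z (f (q + delta *: z) * z 0 i) = delta / d%:R * G q 0 i.
Proof. by rewrite mxE; field; rewrite pnatr_eq0 -lt0n d_gt0 gt_eqF. Qed.

Let L1_mu_coord i : L1 mu (fun z : 'rV[R]_d => z 0 i).
Proof. by under eq_fun do rewrite -dot_deltar; exact: L1_sphere_dot. Qed.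

Let mean_coord i : \int[mu]_z z 0 i = 0.
Proof.
under eq_Rintegral do rewrite -dot_deltar.
by apply: unif_sphere_mean => //; exact: enorm_delta.
Qed.

(* apply the antipodal map to [mean_shift] *)
Let mean_shift_minus q i :
  L1 mu (fun z => f (q + - delta *: z) * z 0 i) /\
  \int[mu]_z (f (q + - delta *: z) * z 0 i) = - (delta / d%:R * G q 0 i).
Proof.
have oppQ : (- 1%:M : 'M[R]_d) *m (- 1%:M : 'M[R]_d)^T = 1%:M.
  by rewrite linearN /= trmx1 mulNmx mul1mx opprK.
have [LQ EQ] := unif_sphere_orthogonal mu_unif oppQ (L1_mu_shift q i).
have E : (fun z : 'rV[R]_d => f (q + - delta *: z) * z 0 i) =
    (fun z => -1 * (f (q + delta *: (z *m (- 1%:M))) * (z *m (- 1%:M)) 0 i)).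
  by apply/funext => z; rewrite mulmxN mulmx1 scalerN scaleNr mxE; ring.
rewrite E; split; first exact: L1Z.
by rewrite expectZ// EQ mean_shift mulN1r.
Qed.

Section unbiased.
Variables (t : nat) (i : 'I_d) (c : O -> R).
Hypotheses (tT : (1 <= t <= K * M)%N) (c_adapted : adapted (pre_u r t) c) (c_L2 : L2 P c).

Let st : sampled t := sampledS opt tT.
Let mpre : pre_u r t `<=` measurable := pre_u_measurable tT.
Let my : measurable_fun setT (y t).
Proof. exact: adapted_measurable mpre (y_adapted tT). Qed.
Let mu_t : measurable_fun setT (u t). Proof. exact: measurable_u st. Qed.

Let cu w := c w * u t w 0 i.

Let cu_L2 : L2 P cu.
Proof.
have := L2_bounded_mul (measurable_coord_comp i mu_t) (coord_u_ae i st) c_L2.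
by under eq_fun do rewrite mulrC.
Qed.

Let cu_adapted : adapted (pre_xi r t) cu.
Proof.
apply: measurable_funM.
  by apply: adapted_sub c_adapted; apply: pre_u_pre_xi; case/andP: tT.
by apply: measurable_coord_comp; exact: u_adapted.
Qed.

Let G_L1 : L1 P (fun w => c w * G (y t w) 0 i).
Proof.
have LG : L2 P (fun w => G (y t w) 0 i).
  apply: (@L2_bounded _ _ _ _ _ (d%:R * L)).
    apply: measurable_coord_comp; apply: (measurableT_comp _ my).
    exact: measurable_sgrad.
  apply: aeW => w; apply: le_trans (coord_le_enorm _ _) _.
  exact: sgrad_le.
exact: L2M.
Qed.

Let u_law : cond_law P (pre_u r t) (u t) (fun=> mu).
Proof. exact: run_u_law. Qed.

Let option1_unbiased : opt = OptionI ->
  \int[P]_w (c w * g t w 0 i) = \int[P]_w (c w * G (y t w) 0 i).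
Proof.
move=> o.
have [LNp _] := noise_plus_variance st; have [LNm _] := noise_minus_variance o tT.
pose Phi (p : (R * 'rV[R]_d) * 'rV[R]_d) :=
  p.1.1 * (f (p.1.2 + delta *: p.2) - f (p.1.2 + - delta *: p.2)) * p.2 0 i.
have mp2 : measurable_fun setT (fun p : (R * 'rV[R]_d) * 'rV[R]_d => p.1.2).
  exact: (measurableT_comp measurable_snd measurable_fst).
have mPhi : measurable_fun setT Phi.
  apply: measurable_funM; last by apply: measurable_coord_comp; exact: measurable_snd.
  apply: measurable_funM; first exact: (measurableT_comp measurable_fst measurable_fst).
  by apply: measurable_funB; apply: measurable_shift2 => //; exact: measurable_snd.
have LPhi : L1 P (fun w => Phi ((c w, y t w), u t w)).
  rewrite /Phi /=; under eq_fun do rewrite -mulrA.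
  apply: L2M => //; apply: (@L2_bounded _ _ _ _ _ (2 * L * delta)).
    apply: measurable_funM; last exact: measurable_coord_comp.
    by apply: measurable_funB; exact: measurable_shift2.
  apply: filterS (u_ae st) => w uw; rewrite normrM -[leRHS]mulr1 ler_pM//.
    apply: le_trans (f_lip _ _) _; rewrite scaleNr opprD opprK addrACA subrr add0r.
    rewrite -mulr2n -scaler_nat !enormZ uw mulr1 !ger0_norm ?(ltW delta_gt0)//.
    by rewrite mulrCA mulrA.
  by rewrite -uw; exact: coord_le_enorm.
have mPhi_mu (p : R * 'rV[R]_d) : L1 mu (fun z => Phi (p, z)) /\
    \int[mu]_z Phi (p, z) = 2 * delta / d%:R * (p.1 * G p.2 0 i).
  have [L1m Em] := mean_shift_minus p.2 i; have L1p := L1_mu_shift p.2 i.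
  rewrite /Phi /=; under eq_fun do rewrite -mulrA mulrBl.
  split; first by apply: L1Z; exact: L1B.
  rewrite expectZ; last exact: L1B.
  by rewrite expectB// Em mean_shift; field; rewrite pnatr_eq0 -lt0n d_gt0.
have := @direction_expect _ _ _ _ _ _ P mu _ (fun w => (c w, y t w)) (u t) Phi _
  (add_rv_sigma_algebra _ _) mpre (measurable_fun_pair c_adapted (y_adapted tT))
  u_law mPhi LPhi (fun p => (mPhi_mu p).1) (fun p => (mPhi_mu p).2).
rewrite /= expectZ// => EPhi.
have Lp := L2M cu_L2 LNp; have Lm := L2M cu_L2 LNm.
transitivity (\int[P]_w (d%:R / (2 * delta) *
    (Phi ((c w, y t w), u t w) + (cu w * noise_plus t w - cu w * noise_minus t w)))).
  apply: eq_Rintegral => w _; rewrite run_gI// mxE /Phi /cu /noise_plus /noise_minus /noise /=.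
  by rewrite scaleNr; ring.
rewrite expectZ; last by apply: L1D => //; exact: L1B.
rewrite expectD//; last exact: L1B.
rewrite expectB// noise_plus_centered// noise_minus_centered//; last first.
  by apply: adapted_sub cu_adapted; exact: sub_add_rv.
by rewrite -EPhi; field; rewrite pnatr_eq0 -lt0n d_gt0 gt_eqF.
Qed.

Let option2_unbiased : opt = OptionII ->
  \int[P]_w (c w * g t w 0 i) = \int[P]_w (c w * G (y t w) 0 i).
Proof.
move=> o.
have st1 : sampled t.-1.
  by rewrite /is_sampled o (leq_trans (leq_pred t))//; case/andP: tT.
have [LNp _] := noise_plus_variance st; have [LNq _] := noise_plus_variance st1.
pose prev w := F (y t.-1 w + delta *: u t.-1 w) (run_xi r t.-1 w).
have prev_adapted : adapted (pre_u r t) prev.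
  have HH : H t.-1 `<=` pre_u r t by exact: sub_add_rv.
  apply: adapted_sub HH _; apply: adapted_oracle => //.
    apply: adapted_sub (pre_xi_history st1) _; exact: query_adapted.
  exact: xi_adapted.
have mprev : measurable_fun setT prev by exact: adapted_measurable prev_adapted.
pose Phi (p : (R * ('rV[R]_d * R)) * 'rV[R]_d) :=
  p.1.1 * (f (p.1.2.1 + delta *: p.2) - p.1.2.2) * p.2 0 i.
have mp2 : measurable_fun setT (fun p : (R * ('rV[R]_d * R)) * 'rV[R]_d => p.1.2).
  exact: (measurableT_comp measurable_snd measurable_fst).
have mPhi : measurable_fun setT Phi.
  apply: measurable_funM; last by apply: measurable_coord_comp; exact: measurable_snd.
  apply: measurable_funM; first exact: (measurableT_comp measurable_fst measurable_fst).
  apply: measurable_funB; last exact: (measurableT_comp measurable_snd mp2).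
  apply: measurable_shift2; last exact: measurable_snd.
  exact: (measurableT_comp measurable_fst mp2).
have LPhi : L1 P (fun w => Phi ((c w, (y t w, prev w)), u t w)).
  rewrite /Phi /=; under eq_fun do rewrite mulrAC.
  apply: (L2M cu_L2).
  have -> : (fun w => f (y t w + delta *: u t w) - prev w) =
      (fun w => (f (y t w + delta *: u t w) - f (y t.-1 w + delta *: u t.-1 w))
        - noise_plus t.-1 w).
    by apply/funext => w; rewrite /noise_plus /noise /prev; ring.
  apply: L2B => //; apply: (@L2_bounded _ _ _ _ _ (4 * L * delta)).
    apply: measurable_funB; first exact: measurable_shift2.
    apply: (measurableT_comp f_measurable).
    by apply: adapted_measurable (query_adapted delta st1); exact: pre_xi_measurable.
  apply: filterS3 (u_ae st) (u_ae st1) (y_step o tT) => w uw uw1 yw.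
  exact: two_query_dist.
have mPhi_mu (p : R * ('rV[R]_d * R)) : L1 mu (fun z => Phi (p, z)) /\
    \int[mu]_z Phi (p, z) = delta / d%:R * (p.1 * G p.2.1 0 i).
  have L1p := L1_mu_shift p.2.1 i; have L1c := L1Z p.2.2 (L1_mu_coord i).
  rewrite /Phi /=; under eq_fun do rewrite -mulrA mulrBl.
  split; first by apply: L1Z; exact: L1B.
  rewrite expectZ; last exact: L1B.
  by rewrite expectB// mean_shift expectZ// mean_coord; ring.
have := @direction_expect _ _ _ _ _ _ P mu _ (fun w => (c w, (y t w, prev w))) (u t) Phi _
  (add_rv_sigma_algebra _ _) mpre
  (measurable_fun_pair c_adapted (measurable_fun_pair (y_adapted tT) prev_adapted))
  u_law mPhi LPhi (fun p => (mPhi_mu p).1) (fun p => (mPhi_mu p).2).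
rewrite /= expectZ// => EPhi.
have Lp := L2M cu_L2 LNp.
transitivity (\int[P]_w (d%:R / delta *
    (Phi ((c w, (y t w, prev w)), u t w) + cu w * noise_plus t w))).
  apply: eq_Rintegral => w _; rewrite run_gII// mxE /Phi /cu /noise_plus /noise /prev /=.
  ring.
rewrite expectZ; last exact: L1D.
rewrite expectD// noise_plus_centered//.
by rewrite -EPhi; field; rewrite pnatr_eq0 -lt0n d_gt0 gt_eqF.
Qed.

(** Given the past and [s_t], the estimator has mean [sgrad (y_t)]: the noises
    are centered given [u_t], and under Option II the reused value multiplies
    the centered direction [u_t]. *)
Lemma g_unbiased : \int[P]_w (c w * g t w 0 i) = \int[P]_w (c w * G (y t w) 0 i).
Proof.
by case: (szo_optionP opt) => o; [exact: option1_unbiased|exact: option2_unbiased].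
Qed.

End unbiased.

End gradient_estimator.

(** * Online-to-nonconvex conversion along one block *)

Section online_to_nonconvex.
Context {R : realType} {d : nat}.
Variables (f : 'rV[R]_d -> R) (Lg D eta : R) (M : nat).
Variables (x y Delta g G : nat -> 'rV[R]_d) (s : nat -> R).
Hypothesis f_diff : forall x, differentiable f x.
Hypothesis grad_lip : forall x y, enorm (grad f x - grad f y) <= Lg * enorm (x - y).
Hypotheses (Lg_gt0 : 0 < Lg) (D_gt0 : 0 < D) (eta_gt0 : 0 < eta) (M_gt0 : (0 < M)%N).
Hypothesis Delta0 : Delta 0 = 0.
Hypothesis Delta_le : forall j, (j < M)%N -> enorm (Delta j) <= D.
Hypothesis Delta_proj : forall j, (j.+1 < M)%N ->
  is_eproj (eball 0 D) (Delta j - eta *: g j) (Delta j.+1).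
Hypothesis xE : forall j, (j < M)%N -> x j.+1 = x j + Delta j.
Hypothesis yE : forall j, (j < M)%N -> y j = x j + s j *: Delta j.
Hypothesis s01 : forall j, (j < M)%N -> 0 <= s j <= 1.

(** The regret bound of projected online gradient descent: the squared
    distance to the comparator is a potential. *)
Lemma ogd_regret w : enorm w <= D ->
  \sum_(j < M) dot (g j) (Delta j - w) <=
    D ^+ 2 / (2 * eta) + eta / 2 * \sum_(j < M) enorm (g j) ^+ 2.
Proof.
move=> wD; have wD2 : enorm w ^+ 2 <= D ^+ 2 by rewrite lerXn2r ?nnegrE ?enorm_ge0// ltW.
pose S n := \sum_(j < n) dot (g j) (Delta j - w).
pose Q n := \sum_(j < n) enorm (g j) ^+ 2.
have step j : enorm (Delta j - eta *: g j - w) ^+ 2 =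
    enorm (Delta j - w) ^+ 2 - 2 * eta * dot (g j) (Delta j - w) + eta ^+ 2 * enorm (g j) ^+ 2.
  rewrite addrAC (enorm_sqrB (Delta j - w)) dotZr enormZ exprMn real_normK ?num_real//.
  by rewrite (dotC _ (g j)); ring.
have pot n : (n < M)%N ->
    2 * eta * S n + enorm (Delta n - w) ^+ 2 <= D ^+ 2 + eta ^+ 2 * Q n.
  elim: n => [_|n IH nM].
    by rewrite /S /Q !big_ord0 !mulr0 addr0 add0r Delta0 sub0r enormN.
  have := IH (ltnW nM); rewrite /S /Q !big_ord_recr /= -/(S n) -/(Q n) => {}IH.
  have : enorm (Delta n.+1 - w) ^+ 2 <= enorm (Delta n - eta *: g n - w) ^+ 2.
    rewrite lerXn2r ?nnegrE ?enorm_ge0//.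
    by apply: eproj_eball_closer (Delta_proj nM) _; rewrite /eball /= subr0.
  rewrite step; lra.
have M1 : (M.-1 < M)%N by rewrite prednK.
(* the last step needs no projection: the potential is nonnegative *)
have := pot _ M1; have := step M.-1; have := sqr_ge0 (enorm (Delta M.-1 - eta *: g M.-1 - w)).
have recr (F : nat -> R) n : (0 < n)%N -> \sum_(j < n) F j = \sum_(j < n.-1) F j + F n.-1.
  by case: n => // n _; rewrite big_ord_recr.
rewrite (recr (fun j => dot (g j) (Delta j - w)))// (recr (fun j => enorm (g j) ^+ 2))//.
rewrite -/(S _) -/(Q _) => h1 h2 h3.
rewrite -(@ler_pM2l _ (2 * eta)) ?mulr_gt0//.
rewrite [leRHS](_ : _ = D ^+ 2 + eta ^+ 2 * (Q M.-1 + enorm (g M.-1) ^+ 2)); last first.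
  by field; rewrite gt_eqF.
lra.
Qed.

(** The mean value theorem gives a point of the segment from [x j] to [x j.+1];
    [y j] is another one, at distance at most [D]. *)
Lemma block_descent :
  f (x M) - f (x 0) <= \sum_(j < M) dot (grad f (y j)) (Delta j) + M%:R * (Lg * D ^+ 2).
Proof.
have step j : (j < M)%N -> f (x j.+1) - f (x j) <= dot (grad f (y j)) (Delta j) + Lg * D ^+ 2.
  move=> jM; rewrite xE//; have [t t01 ->] := mean_value_grad f_diff (x j) (Delta j).
  rewrite -lerBlDl -dotBl; apply: le_trans (cauchy_schwarz _ _) _.
  have DD := Delta_le jM.
  rewrite expr2 mulrA ler_pM ?enorm_ge0//; apply: le_trans (grad_lip _ _) _.
  rewrite ler_wpM2l ?(ltW Lg_gt0)// yE// opprD addrACA subrr add0r -scalerBl enormZ.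
  rewrite -[leRHS]mul1r ler_pM ?enorm_ge0//.
  by move: t01 (s01 jM) => /andP[? ?] /andP[? ?]; rewrite ler_norml; lra.
have main n : (n <= M)%N ->
    f (x n) - f (x 0) <= \sum_(j < n) dot (grad f (y j)) (Delta j) + n%:R * (Lg * D ^+ 2).
  elim: n => [_|n IH nM]; first by rewrite big_ord0 subrr mul0r addr0.
  rewrite big_ord_recr /= -natr1; have := IH (ltnW nM); have := step _ nM; lra.
exact: main.
Qed.

(** The comparator points against the sum of the gradients, so that the regret
    bound controls the norm of that sum. *)
Lemma block_gradient_sum (beta c : R)
    (bias : forall j, (j < M)%N -> enorm (G j - grad f (y j)) <= beta) (c_gt0 : 0 < c) :
  D * enorm (\sum_(j < M) grad f (y j)) <=
    f (x 0) - f (x M) + M%:R * (Lg * D ^+ 2)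
    + D ^+ 2 / (2 * eta) + eta / 2 * \sum_(j < M) enorm (g j) ^+ 2
    + M%:R * (2 * D * beta)
    + D * (c / 2 + enorm (\sum_(j < M) (g j - G j)) ^+ 2 / (2 * c))
    - \sum_(j < M) dot (Delta j) (g j - G j).
Proof.
set S := \sum_(j < M) grad f (y j); set N := \sum_(j < M) (g j - G j).
have [w wD wS] : exists2 w, enorm w <= D & dot S w = - (D * enorm S).
  have [S0|S0] := eqVneq (enorm S) 0.
    by exists 0; rewrite ?enorm0 ?(ltW D_gt0)// dot0r S0 mulr0 oppr0.
  exists (- ((D / enorm S) *: S)).
    rewrite enormN enormZ ger0_norm ?divr_ge0 ?enorm_ge0 ?(ltW D_gt0)//.
    by rewrite divfK.
  by rewrite dotNr dotZr -enorm_sqr; field.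
have reg := ogd_regret wD; have desc := block_descent.
have Nw : dot N w <= D * (c / 2 + enorm N ^+ 2 / (2 * c)).
  apply: le_trans (cauchy_schwarz _ _) _; rewrite mulrC ler_pM ?enorm_ge0//.
  rewrite -subr_ge0 (_ : _ - _ = (c - enorm N) ^+ 2 / (2 * c)).
    by rewrite divr_ge0 ?sqr_ge0// mulr_ge0// ltW.
  by field; rewrite gt_eqF.
have Bw : \sum_(j < M) dot (G j - grad f (y j)) (w - Delta j) <= M%:R * (2 * D * beta).
  apply: (@le_trans _ _ (\sum_(j < M) (2 * D * beta))); last first.
    by rewrite sumr_const card_ord [leRHS]mulr_natl.
  apply: ler_sum => j _; apply: le_trans (cauchy_schwarz _ _) _.
  rewrite mulrC ler_pM ?enorm_ge0//; last exact: bias.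
  apply: le_trans (enormB _ _) _; have := Delta_le (ltn_ord j); lra.
have split_sum : D * enorm S = \sum_(j < M) dot (g j) (Delta j - w)
    - \sum_(j < M) dot (grad f (y j)) (Delta j)
    + \sum_(j < M) dot (G j - grad f (y j)) (w - Delta j)
    + dot N w - \sum_(j < M) dot (Delta j) (g j - G j).
  rewrite -[LHS]opprK -wS dotC dot_sumr (dotC N) dot_sumr.
  rewrite -!sumrN -!big_split /=; apply: eq_bigr => j _.
  by rewrite !(dotBl, dotBr) !(dotC w) !(dotC (Delta j)); ring.
rewrite split_sum; lra.
Qed.

(** All the points of a block lie within distance [M * D] of each other. *)
Lemma block_diameter i j : (i < M)%N -> (j < M)%N -> enorm (y i - y j) <= M%:R * D.
Proof.
(* the weight of [Delta l] in [y i - x 0] *)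
pose a i l := if (l < i)%N then 1 else if l == i then s i else 0.
have xS n : (n <= M)%N -> x n = x 0 + \sum_(l < n) Delta l.
  elim: n => [_|n IH nM]; first by rewrite big_ord0 addr0.
  by rewrite (xE nM) (IH (ltnW nM)) big_ord_recr /= addrA.
have yS k : (k < M)%N -> y k = x 0 + \sum_(l < M) a k l *: Delta l.
  move=> kM; rewrite yE// xS 1?ltnW// -addrA; congr (_ + _).
  rewrite -(big_mkord xpredT (fun l => a k l *: Delta l)).
  rewrite (big_cat_nat (n := k))//; last exact: ltnW.
  congr (_ + _).
    rewrite big_mkord; apply: eq_bigr => l _.
    by rewrite /a ltn_ord scale1r.
  rewrite big_ltn// {1}/a ltnn eqxx big_nat big1 => [|l /andP[kl _]]; first exact: (esym (addr0 _)).
  by rewrite /a ltnNge ltnW//= gtn_eqF// scale0r.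
have a01 k l : (k < M)%N -> 0 <= a k l <= 1.
  by move=> kM; rewrite /a; case: ifP => _; [|case: ifP => _]; rewrite ?lexx ?ler01 ?s01.
move=> iM jM; rewrite yS// (yS j)// opprD addrACA subrr add0r -sumrB.
apply: le_trans (enorm_sum _ _ _) _.
apply: (@le_trans _ _ (\sum_(l < M) D)); last by rewrite sumr_const card_ord [leRHS]mulr_natl.
apply: ler_sum => l _; rewrite -scalerBl enormZ -[leRHS]mul1r ler_pM ?enorm_ge0//.
  by move: (a01 i l iM) (a01 j l jM) => /andP[? ?] /andP[? ?]; rewrite ler_norml; lra.
exact: Delta_le.
Qed.

(** Every point of the block is within [M * D] of the mean of the points. *)
Lemma block_average : enorm (grad f (M%:R^-1 *: \sum_(j < M) y j)) <=
  M%:R^-1 * enorm (\sum_(j < M) grad f (y j)) + Lg * (M%:R * D).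
Proof.
have M0 : M%:R != 0 :> R by rewrite pnatr_eq0 -lt0n.
have Mi0 : 0 <= M%:R^-1 :> R by rewrite invr_ge0.
have mean_const (v : 'rV[R]_d) : v = M%:R^-1 *: \sum_(j < M) v.
  by rewrite sumr_const card_ord -[v *+ M]scaler_nat scalerA mulVf// scale1r.
set yb := M%:R^-1 *: \sum_(j < M) y j.
have close (j : 'I_M) : enorm (yb - y j) <= M%:R * D.
  rewrite {1}(mean_const (y j)) -scalerBr -sumrB enormZ ger0_norm//.
  rewrite mulrC ler_pdivrMr ?ltr0n//; apply: le_trans (enorm_sum _ _ _) _.
  apply: (@le_trans _ _ (\sum_(l < M) (M%:R * D))); last first.
    by rewrite sumr_const card_ord mulr_natr.
  by apply: ler_sum => l _; exact: block_diameter.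
rewrite -[grad f yb](subrK (M%:R^-1 *: \sum_(j < M) grad f (y j))) addrC.
apply: le_trans (enormD _ _) _; rewrite enormZ ger0_norm// lerD2l.
rewrite {1}(mean_const (grad f yb)) -scalerBr -sumrB enormZ ger0_norm//.
rewrite mulrC ler_pdivrMr ?ltr0n//; apply: le_trans (enorm_sum _ _ _) _.
apply: (@le_trans _ _ (\sum_(l < M) (Lg * (M%:R * D)))); last first.
  by rewrite sumr_const card_ord mulr_natr.
apply: ler_sum => l _; apply: le_trans (grad_lip _ _) _.
by rewrite ler_wpM2l// ltW.
Qed.

End online_to_nonconvex.

(** * A uniformly drawn index *)

(** Monotonicity for a possibly non-measurable smaller function, straight from
    the definition of the integral as a supremum. *)
Lemma ge0_le_integral_nomeas {dO : measure_display} {O : measurableType dO}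
    {R : realType} (P : {measure set O -> \bar R}) (h1 h2 : O -> \bar R) :
  (forall w, 0 <= h1 w)%E -> (forall w, h1 w <= h2 w)%E ->
  (\int[P]_w h1 w <= \int[P]_w h2 w)%E.
Proof.
move=> h10 h12; have h20 w : (0 <= h2 w)%E by exact: le_trans (h12 w).
rewrite !ge0_integralTE//; apply: ereal_sup_le => _ [phi phi1 <-].
by exists phi => // w; exact: le_trans (h12 w).
Qed.

Section uniform_index.
Context {dO : measure_display} {O : measurableType dO} {R : realType}.
Variables (P : probability O R) (G : set_system O).
Hypotheses (G_sigma : sigma_algebra setT G) (G_meas : G `<=` measurable).

(** An event of conditional probability [p] given [G], seen as a boolean random
    variable whose conditional law is Bernoulli. *)
Lemma independent_event_integral (b : O -> bool) (p : R) (Z : O -> R) :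
  measurable_fun setT b -> 0 <= p <= 1 ->
  (forall A, G A -> P (A `&` b @^-1` [set true]) = (p%:E * P A)%E) ->
  adapted G Z -> (forall w, 0 <= Z w) ->
  (\int[P]_w (if b w then Z w else 0)%:E = p%:E * \int[P]_w (Z w)%:E)%E.
Proof.
move=> mb p01 bP GZ Z0.
have mbT A : measurable (b @^-1` A) by rewrite -[X in measurable X]setTI; exact: mb.
have mpre A B : G A -> measurable (A `&` b @^-1` B).
  by move=> GA; apply: measurableI; [exact: G_meas|exact: mbT].
have law : cond_law P G b (fun=> bernoulli_prob p).
  split=> // A B GA _; rewrite integral_cst//; last exact: G_meas.
  have PF : P (A `&` b @^-1` [set false]) = ((1 - p)%:E * P A)%E.
    have -> : A `&` b @^-1` [set false] = A `\` (A `&` b @^-1` [set true]).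
      apply/seteqP; split=> w /= [Aw bw]; split=> //; first by case=> _; rewrite bw.
      by apply/negbTE/negP => bw'; exact: bw.
    rewrite measureD//; [|exact: G_meas|exact: mpre|].
      rewrite setIA setIid [X in (_ - X)%E](_ : _ = (p%:E * P A)%E); last exact: bP.
      by rewrite EFinB muleBl ?mul1e// fin_num_measure//; exact: G_meas.
    exact: le_lt_trans (probability_le1 P (G_meas GA)) (ltry _).
  rewrite bernoulli_probE// !diracE.
  have [Bt|Bt] := boolP (true \in B); have [Bf|Bf] := boolP (false \in B);
    rewrite ?mule1 ?mule0 ?adde0 ?add0e.
  - have -> : B = setT by apply/seteqP; split=> // -[] _; exact: set_mem.
    rewrite [X in (X * _)%E](_ : _ = 1%E); last by congr EFin; exact: subrKC.
    by rewrite mul1e preimage_setT setIT.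
  - have -> : B = [set true].
      apply/seteqP; split=> [[]//|_ ->]; last exact: set_mem Bt.
      by move/mem_set; rewrite (negbTE Bf).
    by rewrite bP.
  - have -> : B = [set false].
      apply/seteqP; split=> [[]//|_ ->]; last exact: set_mem Bf.
      by move/mem_set; rewrite (negbTE Bt).
    by rewrite PF.
  - have -> : B = set0.
      by apply/seteqP; split=> // -[] /mem_set; rewrite ?(negbTE Bt) ?(negbTE Bf).
    by rewrite preimage_set0 setI0 measure0 mul0e.
pose k : R.-pker R ~> bool :=
  kprobability (@measurable_cst _ _ R _ setT (bernoulli_prob p : pprobability bool R)).
pose Phi (q : R * bool) := (if q.2 then `|q.1| else 0)%:E.
have mPhi : measurable_fun setT Phi.
  apply/measurable_EFinP; apply: measurable_fun_ifT => //.
  by apply: measurableT_comp => //; exact: measurable_fst.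
have Phi0 q : (0 <= Phi q)%E by rewrite lee_fin /Phi; case: ifP.
have := @cond_law_integral _ _ _ _ _ _ _ P G Z b k G_sigma G_meas GZ law Phi mPhi Phi0.
rewrite /Phi /=; under eq_integral do rewrite ger0_norm//.
move=> ->; rewrite -ge0_integralZl//; last 3 first.
- by apply/measurable_EFinP; exact: adapted_measurable GZ.
- by move=> w _; rewrite lee_fin.
- by rewrite lee_fin; case/andP: p01.
apply: eq_integral => w _; rewrite /k /= /kprobability integral_bernoulli_prob//.
  by rewrite mule0 adde0 ger0_norm.
by move=> c; case: c; rewrite lee_fin.
Qed.


Lemma sum_ord_select (n j : nat) (F : nat -> R) :
  \sum_(k < n) (if j == k.+1 then F k else 0) = if (1 <= j <= n)%N then F j.-1 else 0.
Proof.
case: j => [|j] /=; first by rewrite big1.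
case: ltnP => [jn|nj].
  rewrite (bigD1 (Ordinal jn))//= eqxx big1 ?addr0// => k kj.
  by case: eqP => // -[jk]; case/eqP: kj; apply: val_inj.
rewrite big1// => k _; case: eqP => // -[jk].
by have := ltn_ord k; rewrite -jk ltnNge nj.
Qed.

(** [h] is controlled only where [kout] lies in [1, ..., K], and need not be
    measurable elsewhere: the majorant is [+oo] on that null event. *)
Lemma uniform_index_integral (K : nat) (kout : O -> nat) (Z : nat -> O -> R) (h : O -> R) :
  (0 < K)%N -> measurable_fun setT kout ->
  (forall k, (1 <= k <= K)%N -> forall A, G A ->
    P (A `&` kout @^-1` [set k]) = ((K%:R^-1)%:E * P A)%E) ->
  (forall k, (k < K)%N -> adapted G (Z k)) ->
  (forall k w, 0 <= Z k w) -> (forall w, 0 <= h w) ->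
  (forall k w, (k < K)%N -> kout w = k.+1 -> h w = Z k w) ->
  (\int[P]_w (h w)%:E <= (K%:R^-1)%:E * \sum_(k < K) \int[P]_w (Z k w)%:E)%E.
Proof.
move=> K0 mk law GZ Z0 h0 hZ.
have K01 : 0 <= (K%:R^-1 : R) <= 1 by rewrite invr_ge0 ler0n invf_le1 ?ltr0n// ler1n.
pose b k w := kout w == k.+1.
have mb k : measurable_fun setT (b k).
  apply: (measurable_fun_bool true).
  rewrite (_ : _ `&` _ = setT `&` kout @^-1` [set k.+1]); first exact: mk.
  by congr (_ `&` _); apply/seteqP; split=> w /= /eqP.
have select (F : nat -> O -> R) : (forall k, (k < K)%N -> adapted G (F k)) ->
    (forall k w, 0 <= F k w) ->
    (\int[P]_w (\sum_(k < K) (if b k w then F k w else 0))%:E =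
      (K%:R^-1)%:E * \sum_(k < K) \int[P]_w (F k w)%:E)%E.
  move=> GF F0; under eq_integral do rewrite -sumEFin.
  rewrite ge0_integral_sum//; last 2 first.
  - move=> k; apply/measurable_EFinP; apply: measurable_fun_ifT => //.
    by apply: adapted_measurable (GF k (ltn_ord k)).
  - by move=> k w _; rewrite lee_fin; case: ifP.
  rewrite ge0_sume_distrr; last first.
    by move=> k _; apply: integral_ge0 => w _; rewrite lee_fin.
  apply: eq_bigr => k _; apply: independent_event_integral => //; last exact: GF.
  move=> A GA; rewrite (_ : b k @^-1` [set true] = kout @^-1` [set k.+1]); first exact: (law k.+1 (ltn_ord k)).
  by apply/seteqP; split=> w /= /eqP.
pose range w := (1 <= kout w <= K)%N.
pose N := [set w | ~~ range w].
have mR : measurable_fun setT range.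
  apply: (measurableT_comp (f := fun n => (1 <= n <= K)%N) _ mk).
  by move=> _ B _.
have mN : measurable N.
  have := mR measurableT [set false] I; rewrite setTI.
  congr measurable; apply/seteqP; split=> w; rewrite /N /= /range; [by move=> ->|by move/negPf].


have PN : P N = 0%E.
  have := select (fun _ _ => 1) (fun k _ => measurable_cst _) (fun _ _ => ler01).
  under eq_integral do rewrite /b (sum_ord_select _ _ (fun=> 1)).
  under eq_bigr do rewrite integral_cst// [X in (_ * X)%E]probability_setT mule1.
  rewrite sumEFin sumr_const card_ord -EFinM mulVf ?pnatr_eq0 -?lt0n//.
  rewrite (_ : (fun w => _) = (fun w => (\1_(~` N) w)%:E)).
    rewrite integral_indic//; last exact: measurableC.
    rewrite setIT => PN1; have {}PN1 := etrans (esym (probability_setC P mN)) PN1.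
    have fN : P N \is a fin_num by exact: fin_num_measure.
    move: PN1; rewrite -(fineK fN) -EFinB => -[PN1]; congr EFin; lra.
  apply/funext => w; rewrite indicE -/(range w).
  have -> : (w \in ~` N) = range w.
    by apply/idP/idP => [/set_mem /= /negP|rw]; [rewrite negbK|apply/mem_set => /=; exact/negP/negPn].
  by case: (range w).
pose rest w : \bar R := if range w then 0%E else +oo%E.
have mrest : measurable_fun setT rest by exact: measurable_fun_ifT.
have rest0 : (\int[P]_w rest w = 0)%E.
  rewrite -[RHS](integral0 P setT); apply: ge0_ae_eq_integral => //.
  - by move=> w _; rewrite /rest; case: ifP.
  - exists N; split=> // w /= /not_implyP[_]; rewrite /rest /N /=.
    by case: ifP.
rewrite -select//.
have mS : measurable_fun setT (fun w => (\sum_(k < K) (if b k w then Z k w else 0))%:E).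
  apply/measurable_EFinP/measurable_sum => k; apply: measurable_fun_ifT => //.
  exact: adapted_measurable (GZ k (ltn_ord k)).
have S0 w : 0 <= \sum_(k < K) (if b k w then Z k w else 0).
  by apply: sumr_ge0 => k _; case: ifP.
rewrite -[leRHS]adde0 -rest0 -ge0_integralD//; last 2 first.
- by move=> w _; rewrite lee_fin.
- by move=> w _; rewrite /rest; case: ifP.
apply: ge0_le_integral_nomeas => w; rewrite ?lee_fin//.
rewrite /b (sum_ord_select _ _ (Z ^~ w)) /rest -/(range w); case: ifPn => wr; last by rewrite addey// leey.
rewrite adde0 lee_fin (hZ (kout w).-1)//; last by rewrite prednK//; case/andP: wr.
by case/andP: wr => k1; rewrite -{1}(prednK k1).
Qed.

End uniform_index.

(** * The expected gradient norm at the output *)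

Section block_expectation.
Context {R : realType} {d : nat}.
Context {dX : measure_display} {X : measurableType dX}.
Context {dO : measure_display} {O : measurableType dO}.
Variables (P : probability O R) (mu : probability 'rV[R]_d R).
Variables (Xi : R.-pker 'rV[R]_d ~> X) (F : 'rV[R]_d -> X -> R).
Variables (opt : szo_option) (delta : R) (M K : nat) (eta : R).
Variables (f : 'rV[R]_d -> R) (sigma L : R).
Hypothesis d_gt0 : (0 < d)%N.
Hypothesis mu_unif : is_unif_sphere mu.
Hypothesis f_lip : forall x y, `|f x - f y| <= L * enorm (x - y).
Hypothesis F_measurable : measurable_fun setT (fun p : 'rV[R]_d * X => F p.1 p.2).
Hypothesis F_mean : forall x, (\int[Xi x]_z (F x z)%:E = (f x)%:E)%E.
Hypothesis F_variance : forall x,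
  (\int[Xi x]_z (`|F x z - f x| ^+ 2)%:E <= (sigma ^+ 2)%:E)%E.
Hypotheses (M_gt0 : (0 < M)%N) (delta_gt0 : 0 < delta) (L_gt0 : 0 < L).
Variable Lg : R.
Hypothesis f_diff : forall x, differentiable f x.
Hypothesis grad_lip : forall x y, enorm (grad f x - grad f y) <= Lg * enorm (x - y).
Hypotheses (Lg_gt0 : 0 < Lg) (eta_gt0 : 0 < eta).
Variable r : zo_o2nc_run P mu Xi F opt delta M K eta.

Local Notation H := (history opt (run_s r) (run_u r) (run_xi r) (run_xi' r)).
Local Notation x := (run_x r).
Local Notation y := (run_y r).
Local Notation u := (run_u r).
Local Notation Delta := (run_Delta r).
Local Notation g := (run_g r).
Local Notation D := (delta / M%:R).

Local Notation G := (sgrad mu f delta).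

Let D_gt0 : 0 < D := step_radius_gt0 M_gt0 delta_gt0.

(** The centered part of the estimator; its bias is [G (y t w) - grad f (y t w)]. *)
Definition gnoise t w := g t w - G (y t w).

Let gnoise_coord t w i : gnoise t w 0 i = g t w 0 i - G (y t w) 0 i.
Proof. by rewrite /gnoise mxE; congr (_ + _); rewrite mxE. Qed.

Let mG : measurable_fun setT G.
Proof. by apply: measurable_sgrad; [exact: mu_unif|exact: f_lip|]. Qed.

Let G_adapted t : (1 <= t <= K * M)%N -> adapted (pre_u r t) (fun w => G (y t w)).
Proof.
move=> tT; have Ay : adapted (pre_u r t) (y t) by exact: y_adapted.
exact: (measurableT_comp mG Ay).
Qed.

Let gnoise_adapted t : (1 <= t <= K * M)%N -> adapted (H t) (gnoise t).
Proof.
move=> tT; apply: measurable_rowB; first exact: g_adapted.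
by apply: adapted_sub (pre_u_history tT) _; exact: G_adapted.
Qed.

Let history_meas t : (1 <= t <= K * M)%N -> H t `<=` measurable.
Proof. by case/andP=> _ tT; exact: history_measurable. Qed.

Let coord_L2 (V : O -> 'rV[R]_d) i : measurable_fun setT V ->
  L1 P (fun w => enorm (V w) ^+ 2) -> L2 P (fun w => V w 0 i).
Proof.
move=> mV LV; have mVi := measurableT_comp (measurable_coord i) mV.
split=> //; apply: L1_le (measurable_funX 2 mVi) LV _; apply: aeW => w.
by rewrite normrX lerXn2r ?nnegrE ?enorm_ge0// coord_le_enorm.
Qed.

Let sqr_L1 (V : O -> 'rV[R]_d) : (forall i, L2 P (fun w => V w 0 i)) ->
  L1 P (fun w => enorm (V w) ^+ 2).
Proof.
by move=> LV; under eq_fun do rewrite enorm_sqr_sum; apply: L1_sum => i; case: (LV i).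
Qed.

Let G_coord_L2 t i : (1 <= t <= K * M)%N -> L2 P (fun w => G (y t w) 0 i).
Proof.
move=> tT; apply: (@L2_bounded _ _ _ _ _ (d%:R * L)).
  apply: (measurableT_comp (measurable_coord i)).
  exact: adapted_measurable (pre_u_measurable tT) (G_adapted tT).
apply: aeW => w; apply: le_trans (coord_le_enorm _ _) _.
exact: sgrad_le.
Qed.

Let g_moment t (tT : (1 <= t <= K * M)%N) :=
  g_second_moment d_gt0 mu_unif f_lip F_measurable F_variance M_gt0 delta_gt0 L_gt0 r tT.

Let g_coord_L2 t i : (1 <= t <= K * M)%N -> L2 P (fun w => g t w 0 i).
Proof.
move=> tT; apply: coord_L2; last by case: (g_moment tT).
exact: g_measurable.
Qed.

Let gnoise_coord_L2 t i : (1 <= t <= K * M)%N -> L2 P (fun w => gnoise t w 0 i).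
Proof.
by move=> tT; under eq_fun do rewrite gnoise_coord; apply: L2B; [exact: g_coord_L2|exact: G_coord_L2].
Qed.

Variable B : R.
(** [B] bounds the root mean squares of [g_t] and of [gnoise t]: the right-hand
    side of [g_second_moment] is doubled, and [2 * (d * L) ^+ 2] pays for [G]. *)
Hypothesis B_ge : d%:R ^+ 2 * (12 * sigma ^+ 2 / delta ^+ 2 + 98 * L ^+ 2) <= B ^+ 2.

Let g_moment_B t : (1 <= t <= K * M)%N -> \int[P]_w enorm (g t w) ^+ 2 <= B ^+ 2.
Proof.
move=> tT; apply: le_trans (g_moment tT).2 _; apply: le_trans B_ge.
rewrite ler_wpM2l ?sqr_ge0// lerD//.
  by rewrite ler_wpM2r ?invr_ge0 ?sqr_ge0// ler_wpM2r ?sqr_ge0//; lra.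
by rewrite ler_wpM2r ?sqr_ge0//; lra.
Qed.

Let gnoise_moment t : (1 <= t <= K * M)%N -> \int[P]_w enorm (gnoise t w) ^+ 2 <= B ^+ 2.
Proof.
move=> tT; have [Lg2 Eg] := g_moment tT.
have Ln : L1 P (fun w => enorm (gnoise t w) ^+ 2) by apply: sqr_L1 => i; exact: gnoise_coord_L2.
have Lb := L1D (L1Z 2 Lg2) (L1_cst P (2 * (d%:R * L) ^+ 2)).
apply: le_trans (expect_ae_le Ln Lb _) _.
  apply: aeW => w; rewrite /gnoise; apply: le_trans (enormD_sqr_le _ _) _.
  rewrite enormN lerD2l ler_wpM2l// lerXn2r ?nnegrE ?enorm_ge0//.
    by rewrite mulr_ge0// ltW.
  exact: sgrad_le.
rewrite expectD; [|exact: L1Z|exact: L1_cst].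
rewrite expectZ// expect_cst; apply: le_trans B_ge.
apply: (@le_trans _ _ (2 * (d%:R ^+ 2 * (6 * sigma ^+ 2 / delta ^+ 2 + 48 * L ^+ 2))
   + 2 * (d%:R * L) ^+ 2)); first by rewrite lerD2r ler_wpM2l.
by rewrite le_eqVlt; apply/orP; left; apply/eqP; field; rewrite gt_eqF.
Qed.

(** [g_unbiased], summed over the coordinates. *)
Let gnoise_orthogonal t (V : O -> 'rV[R]_d) : (1 <= t <= K * M)%N ->
  adapted (pre_u r t) V -> (forall i, L2 P (fun w => V w 0 i)) ->
  L1 P (fun w => dot (V w) (gnoise t w)) /\ \int[P]_w dot (V w) (gnoise t w) = 0.
Proof.
move=> tT AV LV; rewrite /dot.
have Lp i : L1 P (fun w => V w 0 i * gnoise t w 0 i).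
  by apply: L2M => //; exact: gnoise_coord_L2.
split; first exact: L1_sum.
rewrite expect_sum// big1// => i _.
have AVi : adapted (pre_u r t) (fun w => V w 0 i).
  exact: (measurableT_comp (measurable_coord i) AV).
have E := g_unbiased d_gt0 mu_unif f_lip F_measurable F_mean F_variance M_gt0
  delta_gt0 L_gt0 i tT AVi (LV i).
under eq_Rintegral do rewrite gnoise_coord mulrBr.
rewrite expectB; [|by apply: L2M => //; exact: g_coord_L2|by apply: L2M => //; exact: G_coord_L2].
by rewrite -E subrr.
Qed.

Let x_bound t w : (t <= K * M)%N -> enorm (x t w) <= t%:R * D.
Proof.
elim: t => [_|t IH tT]; first by rewrite run_x0 enorm0 mul0r.
have t1 : (1 <= t.+1 <= K * M)%N by [].
rewrite run_xE//= -natr1 mulrDl mul1r; apply: le_trans (enormD _ _) _.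
by rewrite lerD//; [exact: IH (ltnW tT)|exact: Delta_bound].
Qed.

Lemma L1_f_x t : (t <= K * M)%N -> L1 P (fun w => f (x t w)).
Proof.
move=> tT; have [Ax _ _] := run_adapted F_measurable r M_gt0 delta_gt0 tT.
have mx : measurable_fun setT (x t).
  by apply: adapted_measurable Ax; exact: history_measurable.
apply: (@L1_bounded _ _ _ _ _ (`|f 0| + L * (t%:R * D))).
  exact: (measurableT_comp (lipschitz_measurable f_lip) mx).
apply: aeW => w; rewrite -lerBlDl; apply: le_trans (lerB_dist _ _) _.
apply: le_trans (f_lip _ _) _; rewrite subr0 ler_wpM2l ?(ltW L_gt0)//.
exact: x_bound.
Qed.

Definition block_mean k w := M%:R^-1 *: \sum_(j < M) y (k * M + j).+1 w.

Section block.
Variable k : nat.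
Hypothesis kK : (k < K)%N.

Let bt j := (k * M + j).+1.

Let btT j : (j < M)%N -> (1 <= bt j <= K * M)%N.
Proof.
move=> jM; rewrite /bt /=; apply: (@leq_trans (k.+1 * M)).
  by rewrite mulSn addnC -addSn leq_add2r.
by rewrite leq_mul2r kK orbT.
Qed.

Let noise_sum n w := \sum_(j < n) gnoise (bt j) w.

Let noise_sum_L2 n i : (n <= M)%N -> L2 P (fun w => noise_sum n w 0 i).
Proof.
move=> nM; under eq_fun do rewrite summxE; apply: L2_sum => j.
by apply: gnoise_coord_L2; apply: btT; exact: leq_trans nM.
Qed.

Let noise_sum_adapted n : (n < M)%N -> adapted (pre_u r (bt n)) (noise_sum n).
Proof.
move=> nM; rewrite /noise_sum.
under eq_fun do rewrite -(big_mkord xpredT (fun j => gnoise (bt j) _)).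
apply: measurable_row_sum => j; rewrite mem_index_iota => /andP[_ jn].
have jM := ltn_trans jn nM.
apply: adapted_sub (@sub_add_rv _ _ _ _ _ _) _.
apply: adapted_sub (gnoise_adapted (btT jM)).
apply: history_mono; rewrite /bt /= ltn_add2l jn /=.
by apply: ltnW; case/andP: (btT nM).
Qed.

(** Orthogonal increments: the second moments of the noises add up. *)
Let noise_sum_moment n : (n <= M)%N ->
  \int[P]_w enorm (noise_sum n w) ^+ 2 <= n%:R * B ^+ 2.
Proof.
elim: n => [_|n IH nM].
  under eq_Rintegral do rewrite /noise_sum big_ord0 enorm0 expr0n /=.
  by rewrite expect_cst mul0r.
have LS i := noise_sum_L2 i (ltnW nM).
have [Lo Eo] := gnoise_orthogonal (btT nM) (noise_sum_adapted nM) LS.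
under eq_Rintegral do rewrite /noise_sum big_ord_recr /= -/(noise_sum n _) enorm_sqrD.
have L1s : L1 P (fun w => enorm (noise_sum n w) ^+ 2) by exact: sqr_L1.
have L1n : L1 P (fun w => enorm (gnoise (bt n) w) ^+ 2).
  by apply: sqr_L1 => i; exact: gnoise_coord_L2 (btT nM).
rewrite expectD//; last by apply: L1D => //; exact: L1Z.
rewrite expectD//; last exact: L1Z.
rewrite expectZ// Eo mulr0 addr0 -natr1 mulrDl mul1r lerD//; first exact: IH (ltnW nM).
exact: gnoise_moment (btT nM).
Qed.

Let kMT : (k * M <= K * M)%N. Proof. by rewrite leq_mul2r ltnW ?orbT. Qed.
Let kMT1 : (k.+1 * M <= K * M)%N. Proof. by rewrite leq_mul2r kK orbT. Qed.

Lemma block_mean_adapted : adapted (H (K * M)) (fun w => enorm (grad f (block_mean k w))).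
Proof.
have mgrad : measurable_fun setT (fun v => enorm (grad f v)).
  apply: (lipschitz_measurable (k := Lg)) => v v'.
  exact: le_trans (enorm_lipschitz _ _) (grad_lip _ _).
apply: (measurableT_comp mgrad); apply: measurable_rowZ; first exact: measurable_cst.
under eq_fun do rewrite -(big_mkord xpredT (fun j => y (bt j) _)).
apply: measurable_row_sum => j; rewrite mem_index_iota => /andP[_ jM].
have Ay : adapted (pre_u r (bt j)) (y (bt j)) by apply: y_adapted => //; exact: btT.
apply: adapted_sub Ay => A HA; apply: (history_mono (t := bt j)).
  by rewrite leqnn andbT; case/andP: (btT jM).
exact: (pre_u_history (btT jM)).
Qed.

Let Q w := \sum_(j < M) enorm (g (bt j) w) ^+ 2.
Let I w := \sum_(j < M) dot (Delta (bt j) w) (gnoise (bt j) w).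

Let Q_moment : L1 P Q /\ \int[P]_w Q w <= M%:R * B ^+ 2.
Proof.
have Lq (j : 'I_M) : L1 P (fun w => enorm (g (bt j) w) ^+ 2).
  by have [] := g_moment (btT (ltn_ord j)).
split; first exact: L1_sum.
rewrite expect_sum//; apply: (@le_trans _ _ (\sum_(j < M) B ^+ 2)).
  by apply: ler_sum => j _; exact: g_moment_B (btT (ltn_ord j)).
by rewrite sumr_const card_ord [leRHS]mulr_natl.
Qed.

Let I_mean : L1 P I /\ \int[P]_w I w = 0.
Proof.
have Lj (j : 'I_M) : L1 P (fun w => dot (Delta (bt j) w) (gnoise (bt j) w)) /\
    \int[P]_w dot (Delta (bt j) w) (gnoise (bt j) w) = 0.
  have tT := btT (ltn_ord j).
  have AD : adapted (pre_u r (bt j)) (Delta (bt j)) by exact: Delta_adapted.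
  apply: gnoise_orthogonal => // i; apply: (@L2_bounded _ _ _ _ _ D).
    apply: (measurableT_comp (measurable_coord i)).
    exact: adapted_measurable (pre_u_measurable tT) AD.
  by apply: aeW => w; apply: le_trans (coord_le_enorm _ _) _; exact: Delta_bound.
split; first by apply: L1_sum => j; case: (Lj j).
by rewrite expect_sum ?big1// => j; case: (Lj j).
Qed.

Variable c : R.
Hypothesis c_gt0 : 0 < c.

Let N2 w := enorm (noise_sum M w) ^+ 2.

Let slack := M%:R * (Lg * D ^+ 2) + D ^+ 2 / (2 * eta)
  + M%:R * (2 * D * (Lg * delta)) + D * (c / 2).

Let bound w := delta^-1 * (f (x (k * M) w) - f (x (k.+1 * M) w)
  + (eta / 2 * Q w + (D / (2 * c) * N2 w - I w)) + slack) + Lg * delta.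

Let M0 : M%:R != 0 :> R. Proof. by rewrite pnatr_eq0 -lt0n. Qed.

Let block_pathwise : {ae P, forall w, enorm (grad f (block_mean k w)) <= bound w}.
Proof.
have s_all : {ae P, forall w, forall j, (j < M)%N -> 0 <= run_s r (bt j) w <= 1}.
  by apply: ae_forall_nat => j jM; exact: s_ae (btT jM).
apply: filterS s_all => w sw.
have btS j : (k * M + j.+1)%N = bt j by rewrite /bt addnS.
pose xs j := x (k * M + j) w.
have xsE j : (j < M)%N -> xs j.+1 = xs j + Delta (bt j) w.
  by move=> jM; rewrite /xs btS run_xE//; exact: btT.
have ysE j : (j < M)%N -> y (bt j) w = xs j + run_s r (bt j) w *: Delta (bt j) w.
  by move=> jM; rewrite run_yE//; exact: btT.
have D0 : Delta (bt 0) w = 0 by rewrite /bt addn0; exact: run_Delta_reset.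
have DD j : (j < M)%N -> enorm (Delta (bt j) w) <= D.
  by move=> jM; apply: Delta_bound => //; exact: btT.
have Dp j : (j.+1 < M)%N -> is_eproj (eball 0 D)
    (Delta (bt j) w - eta *: g (bt j) w) (Delta (bt j.+1) w).
  by move=> jM; rewrite /bt addnS -addnS; exact: run_Delta_update.
have bias j : (j < M)%N -> enorm (G (y (bt j) w) - grad f (y (bt j) w)) <= Lg * delta.
  by move=> _; exact: sgrad_bias.
have := block_gradient_sum (y := fun j => y (bt j) w) (G := fun j => G (y (bt j) w))
  f_diff grad_lip Lg_gt0 D_gt0 eta_gt0 M_gt0 D0 DD Dp xsE ysE sw bias c_gt0.
have := block_average (y := fun j => y (bt j) w) grad_lip Lg_gt0 M_gt0 DD xsE ysE sw.
rewrite -/(block_mean k w); set S := enorm (\sum_(j < M) _).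
rewrite (_ : \sum_(j < M) (g (bt j) w - G (y (bt j) w)) = noise_sum M w)//.
rewrite (_ : \sum_(j < M) dot _ _ = I w)// -/(N2 w) -/(Q w).
rewrite /xs addn0 (_ : (k * M + M = k.+1 * M)%N); last by rewrite mulSn addnC.
move=> avg sum; apply: le_trans avg _; rewrite [M%:R * D]mulrC divfK// lerD2r.
rewrite (_ : M%:R^-1 * S = delta^-1 * (D * S)); last by field; rewrite M0 gt_eqF.
rewrite ler_wpM2l ?invr_ge0 ?(ltW delta_gt0)//; apply: le_trans sum _.
rewrite le_eqVlt; apply/orP; left; apply/eqP; rewrite /slack.
by field; rewrite ?M0 !gt_eqF.
Qed.

(** Expectation of [block_gradient_sum] and [block_average]: the regret against
    the noise has mean [0], and [c] balances the two terms that come from the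
    norm of the sum of the noises. *)
Lemma block_expect :
  L1 P (fun w => enorm (grad f (block_mean k w))) /\
  \int[P]_w enorm (grad f (block_mean k w)) <=
    delta^-1 * (\int[P]_w f (x (k * M) w) - \int[P]_w f (x (k.+1 * M) w))
    + (Lg * D + D / (2 * eta * M%:R) + eta * B ^+ 2 / (2 * D)
       + c / (2 * M%:R) + B ^+ 2 / (2 * c) + 3 * (Lg * delta)).
Proof.
have [LQ EQ] := Q_moment; have [LI EI] := I_mean.
have LN : L1 P N2 by apply: sqr_L1 => i; exact: noise_sum_L2.
have EN := noise_sum_moment (leqnn M); rewrite -/N2 in EN.
have Lx := L1_f_x kMT; have Lx1 := L1_f_x kMT1.
have La := L1B Lx Lx1.
have Ln := L1B (L1Z (D / (2 * c)) LN) LI.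
have Lq := L1D (L1Z (eta / 2) LQ) Ln.
have Lb0 := L1D La Lq; have Lb1 := L1D Lb0 (L1_cst P slack).
have Lb := L1D (L1Z delta^-1 Lb1) (L1_cst P (Lg * delta)).
have mZ : measurable_fun setT (fun w => enorm (grad f (block_mean k w))).
  by apply: adapted_measurable block_mean_adapted; exact: history_measurable.
have LZ : L1 P (fun w => enorm (grad f (block_mean k w))).
  apply: L1_le mZ Lb _; apply: filterS block_pathwise => w.
  by rewrite ger0_norm ?enorm_ge0.
split=> //; apply: le_trans (expect_ae_le LZ Lb block_pathwise) _.
rewrite expectD; [|exact: L1Z|exact: L1_cst].
rewrite expectZ// expectD//; last exact: L1_cst.
rewrite expectD// expectB// expectD//; last exact: L1Z.
rewrite expectB//; last exact: L1Z.
rewrite expectZ// expectZ// EI subr0 !expect_cst.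
have D_ge0 := ltW D_gt0.
have EQ' : eta / 2 * \int[P]_w Q w <= eta / 2 * (M%:R * B ^+ 2).
  by rewrite ler_wpM2l// divr_ge0// ltW.
have EN' : D / (2 * c) * \int[P]_w N2 w <= D / (2 * c) * (M%:R * B ^+ 2).
  by rewrite ler_wpM2l// divr_ge0// mulr_ge0// ltW.
set a := \int[P]_w f (x (k * M) w) - _.
apply: (@le_trans _ _ (delta^-1 * (a + (eta / 2 * (M%:R * B ^+ 2)
    + D / (2 * c) * (M%:R * B ^+ 2)) + slack) + Lg * delta)).
  by rewrite lerD2r ler_wpM2l ?invr_ge0 ?(ltW delta_gt0)// lerD2r lerD2l lerD.
rewrite le_eqVlt; apply/orP; left; apply/eqP; rewrite /slack.
by field; rewrite M0 !gt_eqF.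
Qed.

End block.

Lemma block_mean_output k w : run_kout r w = k.+1 -> run_output r w = block_mean k w.
Proof.
move=> kw; rewrite /run_output kw /= /block_mean addn1; congr (_ *: _).
rewrite -[X in \sum_(X <= _ < _) _]add0n big_addn subSS mulSn addnK big_mkord.
by apply: eq_bigr => j _; rewrite addnS addnC.
Qed.

(** Averaging over the blocks telescopes the decrease of [f]. *)
Lemma output_expect (c gamma : R) : 0 < c -> (0 < K)%N -> (forall v, f 0 - f v <= gamma) ->
  (\int[P]_w (enorm (grad f (run_output r w)))%:E <=
    (gamma / (K%:R * delta) + (Lg * D + D / (2 * eta * M%:R) + eta * B ^+ 2 / (2 * D)
       + c / (2 * M%:R) + B ^+ 2 / (2 * c) + 3 * (Lg * delta)))%:E)%E.
Proof.
move=> c0 K0 fgamma.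
have KM0 : (0 < K * M)%N by rewrite muln_gt0 K0.
have Hs : sigma_algebra setT (H (K * M)).
  case: (K * M)%N KM0 => // t _; case: (szo_optionP opt) => o.
    by rewrite (historySI _ _ _ _ _ o); exact: add_rv_sigma_algebra.
  by rewrite (historySII _ _ _ _ _ o); exact: add_rv_sigma_algebra.
have Hm : H (K * M) `<=` measurable by exact: history_measurable.
have Z0 (k : nat) w : 0 <= enorm (grad f (block_mean k w)) by exact: enorm_ge0.
have h0 w : 0 <= enorm (grad f (run_output r w)) by exact: enorm_ge0.
have hZ k w : (k < K)%N -> run_kout r w = k.+1 ->
    enorm (grad f (run_output r w)) = enorm (grad f (block_mean k w)).
  by move=> _ kw; rewrite (block_mean_output kw).
have := uniform_index_integral Hs Hm K0 (run_kout_measurable r) (run_kout_law (z := r))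
  block_mean_adapted Z0 h0 hZ.
move=> /le_trans; apply.
set C := (_ + 3 * (Lg * delta)).
pose e k := \int[P]_w f (x (k * M) w).
have Ek (k : 'I_K) : (\int[P]_w (enorm (grad f (block_mean k w)))%:E <=
    (delta^-1 * (e k - e k.+1) + C)%:E)%E.
  have [LZ EZ] := block_expect (ltn_ord k) c0.
  rewrite -[leLHS]fineK; first by rewrite lee_fin; exact: EZ.
  exact: integrable_fin_num.
apply: (@le_trans _ _ ((K%:R^-1)%:E * \sum_(k < K) (delta^-1 * (e k - e k.+1) + C)%:E)%E).
  by apply: lee_wpmul2l; [rewrite lee_fin invr_ge0|apply: lee_sum => k _; exact: Ek].
rewrite sumEFin -EFinM lee_fin big_split /= -mulr_sumr.
have -> : \sum_(k < K) (e k - e k.+1) = e 0%N - e K.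
  elim: (K) => [|n IH]; first by rewrite big_ord0 subrr.
  by rewrite big_ord_recr /= IH; ring.
have eK : e 0%N - e K <= gamma.
  have -> : e 0%N = f 0.
    rewrite /e mul0n; under eq_Rintegral do rewrite run_x0.
    exact: expect_cst.
  rewrite lerBlDr -lerBlDl -[leLHS](expect_cst P); apply: expect_ae_le.
  - exact: L1_cst.
  - exact: L1_f_x.
  - by apply: aeW => w; have := fgamma (x (K * M) w); lra.
have Kn0 : K%:R != 0 :> R by rewrite pnatr_eq0 -lt0n.
rewrite sumr_const card_ord -[C *+ K]mulr_natl mulrDr mulKf// lerD2r.
rewrite [leRHS](_ : _ = K%:R^-1 * (delta^-1 * gamma)); last by field; rewrite Kn0 gt_eqF.
by rewrite !ler_wpM2l ?invr_ge0 ?(ltW delta_gt0).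
Qed.

End block_expectation.

(** * Choice of the parameters *)

Section parameters.
Context {R : realType}.
Variables (sigma L Lg gamma eps : R) (d : nat).
Hypotheses (sigma_ge0 : 0 <= sigma) (L_gt0 : 0 < L) (Lg_gt0 : 0 < Lg).
Hypotheses (d_gt0 : (0 < d)%N) (eps_gt0 : 0 < eps) (eps_lt1 : eps < 1).

(** [14 ^+ 2 = 196] dominates the coefficients [12 * 4 ^+ 2] of
    [(sigma * Lg) ^+ 2] and [98] of [L ^+ 2] in the second moment of the
    estimators, once [delta = eps / (4 * Lg)]. *)
Definition noise_const : R := 14 * (sigma * Lg + L).
Definition block_const : R := 32 * noise_const + 2.
Definition count_const : R := 64 * Lg * `|gamma| + 1.

Definition noise_level : R := d%:R * noise_const / eps.
(** At least [32 * noise_level / eps], so that twice the statistical error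
    [noise_level / sqrt M] costs at most [eps / 16]; at least [2], so that the
    discretisation error [Lg * D = eps / (4 * M)] does too. *)
Definition root_length : nat := (Num.truncn (32 * noise_level / eps)).+2.
(** A perfect square, so that its square root is explicit. *)
Definition block_length : nat := (root_length * root_length)%N.
Definition block_count : nat := (Num.truncn (64 * Lg * `|gamma| / eps ^+ 2)).+1.
Definition smoothing_radius : R := eps / (4 * Lg).
(** [D / (B * sqrt M)], which balances the two terms of the regret bound. *)
Definition stepsize : R := smoothing_radius / block_length%:R / (noise_level * root_length%:R).

Let eps2_le1 : eps ^+ 2 <= 1.
Proof. by rewrite expr_le1 // ltW. Qed.

Let inv_eps2 : 1 <= (eps ^+ 2)^-1.
Proof. by rewrite invf_ge1 ?exprn_gt0. Qed.

Lemma noise_const_gt0 : 0 < noise_const.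
Proof. by rewrite mulr_gt0// ltr_wpDl// mulr_ge0// ltW. Qed.

Lemma noise_level_gt0 : 0 < noise_level.
Proof. by rewrite divr_gt0// mulr_gt0 ?ltr0n// noise_const_gt0. Qed.

Lemma smoothing_radius_gt0 : 0 < smoothing_radius.
Proof. by rewrite divr_gt0// mulr_gt0. Qed.

Lemma block_length_gt0 : (0 < block_length)%N.
Proof. by []. Qed.

Lemma stepsize_gt0 : 0 < stepsize.
Proof.
by rewrite !divr_gt0 ?smoothing_radius_gt0 ?ltr0n// mulr_gt0 ?noise_level_gt0 ?ltr0n.
Qed.

Lemma noise_level_ge :
  d%:R ^+ 2 * (12 * sigma ^+ 2 / smoothing_radius ^+ 2 + 98 * L ^+ 2) <= noise_level ^+ 2.
Proof.
rewrite [leRHS](_ : _ = d%:R ^+ 2 * (196 * (sigma * Lg + L) ^+ 2 / eps ^+ 2)); last first.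
  by rewrite /noise_level /noise_const; field; rewrite gt_eqF.
rewrite ler_wpM2l ?sqr_ge0//.
rewrite [X in X + _](_ : _ = 192 * (sigma * Lg) ^+ 2 / eps ^+ 2); last first.
  by rewrite /smoothing_radius; field; rewrite !gt_eqF.
have hL : 98 * L ^+ 2 <= 98 * L ^+ 2 / eps ^+ 2.
  by rewrite ler_peMr// mulr_ge0// sqr_ge0.
apply: (@le_trans _ _ ((192 * (sigma * Lg) ^+ 2 + 98 * L ^+ 2) / eps ^+ 2)).
  by rewrite [leRHS]mulrDl lerD2l.
rewrite ler_wpM2r ?invr_ge0 ?sqr_ge0// sqrrD.
have sL : 0 <= sigma * Lg * L by rewrite !mulr_ge0// ltW.
have := sqr_ge0 (sigma * Lg); have := sqr_ge0 L; rewrite mulr2n; lra.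
Qed.

(** [block_count = O(1 / eps ^+ 2)] and [root_length = O(d / eps ^+ 2)]; under
    either option there are at most [2 * K * M] calls. *)
Lemma szo_count opt : (nb_szo opt block_length block_count)%:R <=
  2 * block_const ^+ 2 * count_const * d%:R ^+ 2 * eps ^- 6.
Proof.
have nb : (nb_szo opt block_length block_count)%:R <=
    2 * (block_count%:R * block_length%:R) :> R.
  rewrite -natrM -[2]/(2%:R) -natrM ler_nat; case: opt => //=.
  by rewrite mul2n -addnn -addn1 leq_add2l muln_gt0.
apply: le_trans nb _.
have d1 : 1 <= d%:R :> R by rewrite ler1n.
have Kle : block_count%:R <= count_const / eps ^+ 2.
  rewrite /block_count /count_const -natr1 [leRHS]mulrDl lerD ?mul1r//.
  by rewrite truncn_le// divr_ge0 ?sqr_ge0// !mulr_ge0// ltW.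
have A0 := ltW noise_const_gt0.
have mle : root_length%:R <= d%:R * block_const / eps ^+ 2.
  rewrite /root_length -natr1 -natr1 -addrA.
  have -> : d%:R * block_const / eps ^+ 2 = 32 * noise_level / eps + 2 * (d%:R / eps ^+ 2).
    by rewrite /block_const /noise_level; field; rewrite gt_eqF.
  apply: lerD.
    rewrite truncn_le// divr_ge0 ?(ltW eps_gt0)// mulr_ge0//.
    exact: ltW noise_level_gt0.
  have : 1 * 1 <= d%:R * (eps ^+ 2)^-1 by rewrite ler_pM.
  lra.
rewrite [leRHS](_ : _ = 2 * (count_const / eps ^+ 2 *
   ((d%:R * block_const / eps ^+ 2) * (d%:R * block_const / eps ^+ 2)))); last first.
  by field; rewrite gt_eqF.
by rewrite ler_wpM2l// ler_pM// /block_length natrM ler_pM.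
Qed.

(** The four groups of terms cost at most [eps / 16], [eps / 16], [eps / 16] and
    [3 / 4 * eps]. *)
Lemma parameters_bound :
  gamma / (block_count%:R * smoothing_radius) + (Lg * (smoothing_radius / block_length%:R)
    + smoothing_radius / block_length%:R / (2 * stepsize * block_length%:R)
    + stepsize * noise_level ^+ 2 / (2 * (smoothing_radius / block_length%:R))
    + noise_level * root_length%:R / (2 * block_length%:R)
    + noise_level ^+ 2 / (2 * (noise_level * root_length%:R))
    + 3 * (Lg * smoothing_radius)) <= eps.
Proof.
have B0 := noise_level_gt0.
have m2 : 2 <= root_length%:R :> R by rewrite (ler_nat _ 2).
have m0 : 0 < root_length%:R :> R by rewrite ltr0n.
have mB : 32 * noise_level / eps <= root_length%:R.
  apply: le_trans (ltW (truncnS_gt _)) _.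
  by rewrite ler_nat.
have K0 : 0 < block_count%:R :> R by rewrite ltr0n.
have Kg : 64 * Lg * `|gamma| / eps ^+ 2 <= block_count%:R by exact: ltW (truncnS_gt _).
rewrite /stepsize /block_length natrM.
set B := noise_level in B0 mB *; set m : R := root_length%:R in m2 m0 mB *.
set k : R := block_count%:R in K0 Kg *.
have t1 : gamma / (k * smoothing_radius) <= eps / 16.
  have kr : 0 < k * smoothing_radius by apply: mulr_gt0 => //; exact: smoothing_radius_gt0.
  rewrite ler_pdivrMr//.
  apply: le_trans (ler_norm _) _; move: Kg; rewrite ler_pdivrMr ?exprn_gt0// => Kg.
  rewrite (_ : eps / 16 * (k * smoothing_radius) = k * eps ^+ 2 / (64 * Lg)); last first.
    by rewrite /smoothing_radius; field; rewrite gt_eqF.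
  by rewrite ler_pdivlMr ?mulr_gt0// mulrC.
have t2 : B / m <= eps / 32.
  rewrite ler_pdivrMr//; move: mB; rewrite ler_pdivrMr// => mB.
  rewrite (_ : eps / 32 * m = m * eps / 32); last by ring.
  by rewrite ler_pdivlMr// mulrC.
have t3 : eps / (4 * (m * m)) <= eps / 16.
  rewrite ler_pM2l// lef_pV2 ?posrE ?mulr_gt0//.
  have : 2 * 2 <= m * m by rewrite ler_pM.
  lra.
rewrite [X in _ + X <= _](_ : _ = eps / (4 * (m * m)) + 2 * (B / m) + 3 / 4 * eps); last first.
  by rewrite /smoothing_radius; field; rewrite !gt_eqF.
move: t1 t2 t3; set a := gamma / _; set b := B / m; set e := eps / (4 * _).
by move=> t1 t2 t3; move: eps_gt0; lra.
Qed.

End parameters.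

Theorem theorem4p1 (R : realType) (gamma sigma L Lg : R)
    (sigma_ge0 : 0 <= sigma) (L_gt0 : 0 < L) (Lg_gt0 : 0 < Lg) :
  exists C eps0 : R, 0 < C /\ 0 < eps0 /\
  forall (d : nat) (d_gt0 : (0 < d)%N)
    (f : 'rV[R]_d -> R)
    (f_bounded_below : has_lbound (range f))
    (gammaE : gamma = f 0 - inf (range f))
    (f_lipschitz : forall x y, `|f x - f y| <= L * enorm (x - y))
    (f_differentiable : forall x, differentiable f x)
    (grad_lipschitz : forall x y,
      enorm (grad f x - grad f y) <= Lg * enorm (x - y))
    (dX : measure_display) (X : measurableType dX)
    (Xi : R.-pker 'rV[R]_d ~> X) (F : 'rV[R]_d -> X -> R)
    (F_measurable : measurable_fun setT (fun p : 'rV[R]_d * X => F p.1 p.2))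
    (F_mean : forall x, (\int[Xi x]_z (F x z)%:E = (f x)%:E)%E)
    (F_variance : forall x,
      (\int[Xi x]_z (`|F x z - f x| ^+ 2)%:E <= (sigma ^+ 2)%:E)%E)
    (eps : R) (eps_gt0 : 0 < eps) (eps_small : eps < eps0)
    (opt : szo_option),
  exists (M K : nat) (eta : R),
    [/\ (0 < M)%N, (0 < K)%N, 0 < eta,
        (nb_szo opt M K)%:R <= C * d%:R ^+ 2 * eps ^- 6 &
        forall (dO : measure_display) (O : measurableType dO)
          (P : probability O R)
          (mu : probability 'rV[R]_d R) (mu_unif : is_unif_sphere mu)
          (r : zo_o2nc_run P mu Xi F opt (eps / (4 * Lg)) M K eta),
        ('E_P[fun w => enorm (grad f (run_output r w))] <= eps%:E)%E].
Proof.
exists (2 * block_const sigma L Lg ^+ 2 * count_const Lg gamma), 1.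
have A0 : 0 < noise_const sigma L Lg by exact: noise_const_gt0.
have b0 : 0 < block_const sigma L Lg by rewrite /block_const; lra.
have c0 : 0 < count_const Lg gamma.
  by rewrite /count_const -mulrA ltr_wpDl// mulr_ge0// mulr_ge0// ltW.
split; [|split=> //]; first by rewrite mulr_gt0// mulr_gt0// exprn_gt0.
move=> d d_gt0 f f_lb gammaE f_lip f_diff grad_lip dX X Xi F mF F_mean F_var eps eps_gt0 eps_lt1 opt.
exists (block_length sigma L Lg eps d), (block_count Lg gamma eps), (stepsize sigma L Lg eps d).
have eta_gt0 := stepsize_gt0 sigma_ge0 L_gt0 Lg_gt0 d_gt0 eps_gt0.
split=> //; first exact: szo_count.
move=> dO O P mu mu_unif r; rewrite unlock.
have B_gt0 := noise_level_gt0 sigma_ge0 L_gt0 Lg_gt0 d_gt0 eps_gt0.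
have fgamma v : f 0 - f v <= gamma.
  by rewrite gammaE lerD2l lerN2; apply: ge_inf => //; exists v.
have c_gt0 : 0 < noise_level sigma L Lg eps d * (root_length sigma L Lg eps d)%:R.
  by rewrite mulr_gt0// ltr0n.
have h := (output_expect d_gt0 mu_unif f_lip mF F_mean F_var (block_length_gt0 _ _ _ _ _)
  (smoothing_radius_gt0 Lg_gt0 eps_gt0) L_gt0 f_diff grad_lip Lg_gt0 eta_gt0 r
  (noise_level_ge d sigma_ge0 L_gt0 Lg_gt0 eps_gt0 eps_lt1) c_gt0 (ltn0Sn _) fgamma).
apply: le_trans h _.
rewrite lee_fin; exact: parameters_bound.
Qed.
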